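(* For every integer $r\ge 1$ there is an integer $N(r)$, depending only on $r$, such that the following holds. Let $\mathcal I=(I_n)_{n\ge 1}$ be an $\mathrm{Inc}$-invariant (not necessarily saturated) chain of eventually nonzero edge ideals with stability index $\mathrm{ind}(\mathcal I)=r$. Then for all $n\ge N(r)$ there is an equality $\operatorname{reg} I_n=\operatorname{reg} I_{n+1}$, and moreover $\operatorname{reg} I_n\in\{2,3\}$.
   Context: Let $\Bbbk$ be a field, $R_n=\Bbbk[x_1,\ldots,x_n]$ the standard graded polynomial ring, $R=\bigcup_{n\ge 1}R_n$, and $\mathbb N$ the set of positive integers. $\mathrm{Inc}$ is the monoid of strictly increasing functions $\pi:\mathbb N\to\mathbb N$ under composition, acting on $R$ by $\Bbbk$-algebra endomorphisms via $\pi(x_i)=x_{\pi(i)}$. A family $\mathcal I=(I_n)_{n\ge 1}$ of ideals $I_n\subseteq R_n$ is an $\mathrm{Inc}$-invariant chain if $\pi(I_m)\subseteq I_n$ for all $1\le m<n$ and all $\pi\in\mathrm{Inc}$ with $\pi(m)\le n$. For $m\le n$ put $\mathrm{Inc}_{m,n}=\{\pi\in\mathrm{Inc}\mid \pi(m)\le n\}$. The stability index $\mathrm{ind}(\mathcal I)$ is the smallest $r\ge 1$ such that for all $n\ge r$, $I_n$ is the ideal of $R_n$ generated by $\mathrm{Inc}_{r,n}(I_r)=\{\pi(f):\pi\in \mathrm{Inc}_{r,n}, f\in I_r\}$ (such an $r$ always exists). An edge ideal is an ideal of $R_n$ generated by squarefree quadratic monomials. A chain of eventually nonzero edge ideals is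 one in which each $I_n$ is an edge ideal and $I_n\neq 0$ for all $n\gg 0$. The chain is saturated if $I_n=I_{n+1}\cap R_n$ for all $n\ge 1$. $\operatorname{reg}$ denotes Castelnuovo–Mumford regularity: $\operatorname{reg} M=\sup\{j-i:\operatorname{Tor}_i^{R_n}(\Bbbk,M)_j\ne 0\}$ for a finitely generated graded $R_n$-module $M$. *)

(* Defs.v *)
From HB Require Import structures.
From mathcomp Require Import all_boot all_order all_algebra.
From mathcomp Require Import mpoly.
(* mpoly must be loaded before the classical library: in the other order
   their notations clash. *)
From mathcomp Require Import boolp classical_sets constructive_ereal.

Set Implicit Arguments.
Unset Strict Implicit.
Unset Printing Implicit Defensive.

Import Order.TTheory GRing.Theory Num.Theory.
Local Open Scope classical_set_scope.
Local Open Scope ring_scope.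

(* R_n is [{mpoly k[n]}].  Variables are numbered from 0: ['X_i] with
   [i : 'I_n] stands for x_{i+1}, and likewise a strictly increasing self-map
   of the positive integers is given by its conjugate [pi : nat -> nat] under
   i |-> i+1.  Thus the condition pi(m) <= n on positive integers reads
   [pi m.-1 < n]. *)

Definition is_ideal (R : comNzRingType) (J : set R) : Prop :=
  [/\ J 0, (forall f g, J f -> J g -> J (f + g)) &
      (forall c f, J f -> J (c * f))].

Definition ideal_gen (R : comNzRingType) (G : set R) : set R :=
  smallest (@is_ideal R) G.

Section Regularity.
Variables (k : fieldType) (n : nat).
Local Notation S := {mpoly k[n]}.

(* Column vectors represent elements of the graded free module with basis
   e_0, ..., e_{b-1} in degrees [deg 0], ..., [deg (b-1)]; [homog_vec deg j v]
   says that [v] is homogeneous of degree [j] (zero is homogeneous of every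
   degree). *)
Definition homog_vec (b : nat) (deg : 'I_b -> int) (j : int) (v : 'cV[S]_b) :
    Prop :=
  forall (a : 'I_b) (m : 'X_{1..n}),
    m \in msupp (v a ord0) -> (mdeg m)%:Z + deg a = j.

(* A graded resolution ... -> P_1 -> P_0 -> k -> 0 of k = R_n/(x_1,...,x_n),
   in degree 0, by finitely generated graded free modules: P_i has rank
   [rk i], the a-th basis vector has degree [deg a], the matrix [dif i] is
   the map P_{i+1} -> P_i and [aug] lists the images in k of the basis vectors
   of P_0. *)
Record resolution_k := ResolutionK {
  rk : nat -> nat;
  deg : forall i, 'I_(rk i) -> int;
  dif : forall i, 'M[S]_(rk i, rk i.+1);
  aug : 'I_(rk 0) -> k;
  dif_homog : forall i c, homog_vec (@deg i) (deg c) (col c (dif i));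
  aug_homog : forall a, aug a != 0 -> deg a = 0;
  aug_surj : exists a, aug a != 0;
  exact_0 : forall v : 'cV[S]_(rk 0),
    \sum_a (v a ord0)@_0%MM * aug a = 0 <-> exists w, v = dif 0 *m w;
  exact_S : forall i (v : 'cV[S]_(rk i.+1)),
    dif i *m v = 0 <-> exists w, v = dif i.+1 *m w
}.

(* For P_i free of rank [rk P i], the module P_i (x) J is the set of column
   vectors with all entries in J. *)
Definition tor_chain (P : resolution_k) (J : set S) (i : nat) (j : int) :
    set 'cV[S]_(rk P i) :=
  [set v : 'cV[S]_(rk P i) | (forall a, J (v a ord0)) /\
     homog_vec (@deg P i) j v].

Definition tor_cycle (P : resolution_k) (J : set S) (i : nat) (j : int) :
    set 'cV[S]_(rk P i) :=
  @tor_chain P J i j `&`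
  match i return set 'cV[S]_(rk P i) with
  | 0 => setT
  | i'.+1 => [set v | dif P i' *m v = 0]
  end.

Definition tor_boundary (P : resolution_k) (J : set S) (i : nat) (j : int) :
    set 'cV[S]_(rk P i) :=
  [set dif P i *m w | w in @tor_chain P J i.+1 j].

(* Tor_i^{R_n}(k, J)_j <> 0, that is H_i(P (x) J)_j <> 0.  Up to isomorphism
   this homology does not depend on the resolution P of k. *)
Definition Tor_neq0 (J : set S) (i : nat) (j : int) : Prop :=
  exists P : resolution_k, ~ (@tor_cycle P J i j `<=` @tor_boundary P J i j).

(* The supremum is taken in the integers extended by -oo and +oo, where every
   set has one; in particular the zero ideal has regularity -oo. *)
Definition reg (J : set S) : \bar int :=
  supremum -oo%E
    [set d | exists (i : nat) (j : int), Tor_neq0 J i j /\ d = (j - i%:Z)%:E].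

End Regularity.

Definition Inc (pi : nat -> nat) : Prop := {homo pi : i j / (i < j)%N}.

Definition Inc_mn (m n : nat) (pi : nat -> nat) : Prop :=
  Inc pi /\ (pi m.-1 < n)%N.

Section Chains.
Variable k : fieldType.

Definition xvar (n j : nat) : {mpoly k[n]} :=
  if (insub j : option 'I_n) is Some j' then 'X_j' else 0.

(* The action R_m -> R_n of [pi].  It is only used for [pi] in Inc_{m,n}, when
   all indices [pi i] with [i < m] are in range and the value 0 of [xvar] never
   occurs. *)
Definition Inc_act (m n : nat) (pi : nat -> nat) (f : {mpoly k[m]}) :
    {mpoly k[n]} :=
  f \mPo [tuple xvar n (pi i) | i < m].

(* The member of index 0 of a family is irrelevant: families of ideals are
   indexed by n >= 1. *)
Definition Inc_invariant_chain (I : forall n, set {mpoly k[n]}) : Prop :=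
  (forall n, (1 <= n)%N -> is_ideal (I n)) /\
  (forall m n, (1 <= m)%N -> (m < n)%N ->
     forall pi, Inc_mn m n pi -> forall f, I m f -> I n (Inc_act n pi f)).

Definition Inc_orbit (m n : nat) (J : set {mpoly k[m]}) : set {mpoly k[n]} :=
  [set g | exists pi f, [/\ Inc_mn m n pi, J f & g = Inc_act n pi f]].

Definition stable_from (I : forall n, set {mpoly k[n]}) (r : nat) : Prop :=
  (1 <= r)%N /\
  forall n, (r <= n)%N -> I n = ideal_gen (@Inc_orbit r n (I r)).

Definition stability_index (I : forall n, set {mpoly k[n]}) (r : nat) : Prop :=
  stable_from I r /\ forall s, stable_from I s -> (r <= s)%N.

Definition sqfree_quadratic (n : nat) (m : 'X_{1..n}) : Prop :=
  mdeg m = 2 /\ forall i, (m i <= 1)%N.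

(* The generating set may be empty: 0 is an edge ideal. *)
Definition edge_ideal (n : nat) (J : set {mpoly k[n]}) : Prop :=
  exists M : set 'X_{1..n},
    (forall m, M m -> sqfree_quadratic m) /\
    J = ideal_gen [set 'X_[m] | m in M].

Definition eventually_nonzero (I : forall n, set {mpoly k[n]}) : Prop :=
  exists n0, forall n, (n0 <= n)%N -> I n <> [set 0].

End Chains.

(* Main.v *)
Require Import Defs.
From mathcomp Require Import all_boot all_order all_algebra.
From mathcomp Require Import mpoly.
From mathcomp Require Import boolp classical_sets constructive_ereal.
From mathcomp Require Import zify ring.

Set Implicit Arguments.
Unset Strict Implicit.
Unset Printing Implicit Defensive.

Import Order.TTheory GRing.Theory Num.Theory.
Local Open Scope classical_set_scope.
Local Open Scope ring_scope.

(* Let [E] be the edge set of the graph of I_r. By stability [a < b] is an edge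
   of the graph G_n of I_n iff some [i < j] in [E] satisfies [i <= a],
   [j - i <= b - a] and [r - j <= n - b].

   Upper bounds: removing a vertex [x] gives
   reg I(G) <= max (reg I(G - N[x]) + 1, reg I(G - x)), by Mayer-Vietoris for
   [x (I : x) = I /\ (x)] and [I + (x)]. Hence reg I(G) <= 2 if the complement
   of [G] has a perfect elimination ordering (for instance if it is an interval
   graph), and reg I(G) <= 3 if the vertices can be removed one at a time so
   that each G - N[x] is of the first kind, down to a graph of the first kind.
   For n large this applies to G_n: the middle vertices are adjacent to
   everything that is not isolated or close to them; once they are gone, remove
   the vertices at the left end, starting from the right.

   Lower bounds: an explicit Koszul cycle shows that reg I(G) >= 3 if some
   non-edge lies on a cycle, but on no triangle, of the complement of an induced
   subgraph of [G].

   Which case occurs does not depend on n. Let i-, i+ (j-, j+) be the least and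
   greatest left (right) end points of the edges in [E]. The limit is 2 iff
   (i-, j+) is in [E], or some [i < j] in [E] has [i <= j-] and [j >= i+] and some
   edge has width 1. *)

(** * Monomial ideals as sets of monomials *)

Section MonomialIdeals.
Variables (k : fieldType) (n : nat).
Local Notation S := {mpoly k[n]}.
Local Notation mon := 'X_{1..n}.

(** For upward closed [M] this is the monomial ideal with monomials [M]. Sums and intersections of
    such ideals become unions and intersections of sets. *)
Definition monI (M : set mon) : set S :=
  [set f | forall m, m \in msupp f -> M m].

Definition upclosed (M : set mon) : Prop := forall m m', M m -> M (m' + m)%MM.

Lemma monI0 M : monI M 0.
Proof. by move=> m; rewrite msupp0. Qed.

Lemma monID M f g : monI M f -> monI M g -> monI M (f + g).
Proof.
by move=> hf hg m /msuppD_le; rewrite mem_cat => /orP[/hf|/hg].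
Qed.

Lemma monIM M c f : upclosed M -> monI M f -> monI M (c * f).
Proof.
by move=> hM hf m /msuppM_le /allpairsP[[m1 m2] /= [_ /hf h ->]]; apply: hM.
Qed.

Lemma monI_sum M (T : Type) (r : seq T) (Q : pred T) (F : T -> S) :
  (forall t, Q t -> monI M (F t)) -> monI M (\sum_(t <- r | Q t) F t).
Proof.
by move=> h; elim/big_ind: _ => //; [exact: monI0 | move=> *; exact: monID].
Qed.

Lemma monI_ideal M : upclosed M -> is_ideal (monI M).
Proof.
move=> hM; split; first exact: monI0.
- by move=> f g; apply: monID.
- by move=> c f; apply: monIM.
Qed.

Definition mpart (M : set mon) (f : S) : S :=
  \sum_(m : 'X_{1..n < msize f}) (if `[< M m >] then f@_m else 0) *: 'X_[m].

Lemma mcoeff_mpart M f m : (mpart M f)@_m = if `[< M m >] then f@_m else 0.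
Proof.
have [lt|ge] := ltnP (mdeg m) (msize f).
  by rewrite /mpart (mcoeff_mpoly (fun m => if `[< M m >] then f@_m else 0)).
have -> : f@_m = 0 by apply/memN_msupp_eq0/negP => /msize_mdeg_lt; lia.
rewrite if_same /mpart raddf_sum big1 //= => m' _.
rewrite mcoeffZ mcoeffX; case: eqP => [e|_]; last by rewrite mulr0.
by have := bmdeg m'; rewrite e; lia.
Qed.

Lemma msupp_mpart M f m : m \in msupp (mpart M f) -> m \in msupp f /\ M m.
Proof.
rewrite !mcoeff_msupp mcoeff_mpart; case: asboolP => //; last by rewrite eqxx.
Qed.

Lemma mpartDC M f : f = mpart M f + mpart (~` M) f.
Proof.
apply/mpolyP => m; rewrite mcoeffD !mcoeff_mpart.
case: asboolP => [h|h]; case: asboolP => //=; rewrite ?addr0 ?add0r //.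
Qed.

Definition mquot (t : 'I_n) (f : S) : S :=
  \sum_(m : 'X_{1..n < msize f}) f@_(m + U_(t))%MM *: 'X_[m].

Lemma mcoeff_mquot t f m : (mquot t f)@_m = f@_(m + U_(t))%MM.
Proof.
have [lt|ge] := ltnP (mdeg m) (msize f).
  by rewrite /mquot (mcoeff_mpoly (fun m => f@_(m + U_(t))%MM)).
have -> : f@_(m + U_(t))%MM = 0.
  apply/memN_msupp_eq0/negP => /msize_mdeg_lt; rewrite mdegD; lia.
rewrite /mquot raddf_sum big1 //= => m' _.
rewrite mcoeffZ mcoeffX; case: eqP => [e|_]; last by rewrite mulr0.
by have := bmdeg m'; rewrite e; lia.
Qed.

Lemma mcoeffXU_mul t (f : S) m :
  ('X_t * f)@_m = if (0 < m t)%N then f@_(m - U_(t))%MM else 0.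
Proof.
case: ifP => h.
  have e : m = (U_(t) + (m - U_(t)))%MM.
    by rewrite addmC submK //; apply/mnm_lepP => i; rewrite mnm1E; case: eqP => // <-.
  by rewrite {1}e mulrC mcoeffMX.
apply/memN_msupp_eq0/negP => /msuppM_le /allpairsP[[m1 m2] /= [+ _ e]].
rewrite msuppX inE => /eqP e1; move: h; rewrite e mnmDE e1 mnm1E eqxx; lia.
Qed.

Lemma mpolyX_eq0 (m : mon) : ('X_[m] == 0 :> S) = false.
Proof. by apply/eqP => e; have := msuppX k m; rewrite e msupp0. Qed.

Lemma mulX_mquot t f :
  (forall m, m \in msupp f -> 0 < m t)%N -> f = 'X_t * mquot t f.
Proof.
move=> h; apply/mpolyP => m; rewrite mcoeffXU_mul mcoeff_mquot.
case: ifP => ht.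
  by rewrite submK //; apply/mnm_lepP => i; rewrite mnm1E; case: eqP => // <-.
by apply/memN_msupp_eq0/negP => /h; rewrite ht.
Qed.

Lemma msupp_mquot t f m : m \in msupp (mquot t f) -> (m + U_(t))%MM \in msupp f.
Proof. by rewrite !mcoeff_msupp mcoeff_mquot. Qed.

End MonomialIdeals.

Arguments monI k {n} M _ : rename.

(** * Upper bounds on the degrees of Tor *)

Section TorVanishing.
Variables (k : fieldType) (n : nat) (P : resolution_k k n).
Local Notation S := {mpoly k[n]}.
Local Notation mon := 'X_{1..n}.
Implicit Types (M A B : set mon) (d : int).

(** Relative to the fixed but arbitrary resolution [P]: since [Tor_neq0] admits any resolution,
    bounding [reg] means proving this for every [P]. *)
Definition reg_le M d : Prop := forall i j, d < j - i%:Z ->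
  @tor_cycle k n P (monI k M) i j `<=` @tor_boundary k n P (monI k M) i j.

Lemma reg_leW M d d' : d <= d' -> reg_le M d -> reg_le M d'.
Proof. by move=> le h i j lt; apply: h; lia. Qed.

Lemma msupp_mulmx p q (D : 'M[S]_(p, q)) (w : 'cV_q) a m :
  m \in msupp ((D *m w) a ord0) ->
  exists c m1 m2, [/\ m1 \in msupp (D a c), m2 \in msupp (w c ord0) &
                      m = (m1 + m2)%MM].
Proof.
rewrite mxE => hm.
suff [c hc] : exists c, m \in msupp (D a c * w c ord0).
  by move: hc => /msuppM_le /allpairsP[[m1 m2] /= [h1 h2 ->]]; exists c, m1, m2.
apply/not_existsP => h; move: hm; rewrite mcoeff_msupp raddf_sum /= big1 ?eqxx //.
by move=> c _; apply/memN_msupp_eq0/negP.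
Qed.

Lemma tor_chain_dif M i j w : upclosed M -> @tor_chain k n P (monI k M) i.+1 j w ->
  @tor_chain k n P (monI k M) i j (dif P i *m w).
Proof.
move=> hM [hw hj]; split => a.
  rewrite mxE; apply: monI_sum => c _; exact: monIM.
move=> m /msupp_mulmx[c [m1 [m2 [h1 h2 ->]]]].
have := @dif_homog _ _ P i c a m1; rewrite mxE => /(_ h1) e1.
have := hj c m2 h2; rewrite mdegD; lia.
Qed.

Lemma tor_chainD M i j v w : @tor_chain k n P (monI k M) i j v ->
  @tor_chain k n P (monI k M) i j w -> @tor_chain k n P (monI k M) i j (v + w).
Proof.
move=> [v1 v2] [w1 w2]; split => a; rewrite mxE; first exact: monID.
by move=> m /msuppD_le; rewrite mem_cat => /orP[/v2|/w2].
Qed.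

Lemma tor_chainN M i j v : @tor_chain k n P (monI k M) i j v ->
  @tor_chain k n P (monI k M) i j (- v).
Proof.
move=> [v1 v2]; split=> a; rewrite mxE => m; rewrite (perm_mem (msuppN _)).
  exact: v1.
exact: v2.
Qed.

Lemma tor_chainS M M' i j v : (M `<=` M') ->
  @tor_chain k n P (monI k M) i j v -> @tor_chain k n P (monI k M') i j v.
Proof. by move=> h [v1 v2]; split => // a m /v1 /h. Qed.

Lemma tor_chain_split A B i j v : @tor_chain k n P (monI k (A `|` B)) i j v ->
  exists a b, [/\ @tor_chain k n P (monI k A) i j a,
    @tor_chain k n P (monI k B) i j b & v = a + b].
Proof.
move=> [v1 v2]; exists (map_mx (mpart A) v), (map_mx (mpart (~` A)) v); split.
- split=> a m; rewrite mxE => /msupp_mpart[h1 h2] //; exact: v2.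
- split=> a m; rewrite mxE => /msupp_mpart[h1 h2]; last exact: v2.
  by have [] := v1 _ _ h1.
- by apply/matrixP => a b; rewrite !mxE -mpartDC.
Qed.

Lemma tor_chainI A B i j v : @tor_chain k n P (monI k A) i j v ->
  @tor_chain k n P (monI k B) i j v -> @tor_chain k n P (monI k (A `&` B)) i j v.
Proof. by move=> [v1 v2] [w1 _]; split=> // a m h; split; [apply: v1 h|apply: w1 h]. Qed.

Lemma dif_dif i (w : 'cV_(rk P i.+2)) : dif P i *m (dif P i.+1 *m w) = 0.
Proof. by apply/exact_S; exists w. Qed.

(** Mayer-Vietoris, exactness at Tor_i of the sum. The connecting map lowers [i] by one and so
    raises [j - i] by one, hence [d + 1] for the intersection. *)
Lemma reg_leU A B d : upclosed A -> upclosed B ->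
  reg_le A d -> reg_le B d -> reg_le (A `&` B) (d + 1) ->
  reg_le (A `|` B) d.
Proof.
move=> hA hB rA rB rAB i j lt v.
have sA : (A `<=` A `|` B) by move=> x; left.
have sB : (B `<=` A `|` B) by move=> x; right.
have bd a b : @tor_cycle k n P (monI k A) i j a -> @tor_cycle k n P (monI k B) i j b ->
  @tor_boundary k n P (monI k (A `|` B)) i j (a + b).
  move=> /(rA _ _ lt)[wa ha <-] /(rB _ _ lt)[wb hb <-].
  exists (wa + wb); last by rewrite mulmxDr.
  by apply: tor_chainD; [apply: tor_chainS ha|apply: tor_chainS hb].
case: i lt v bd => [|i] lt v bd [cv zv].
  have [a [b [ha hb ->]]] := tor_chain_split cv; exact: bd.
have [a [b [ha hb e]]] := tor_chain_split cv.
have eab : dif P i *m a = - (dif P i *m b).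
  by apply/eqP; rewrite -addr_eq0 -mulmxDr -e; apply/eqP.
(* The connecting map: the boundaries of [a] and [b] are opposite, so their entries lie in both
   ideals. *)
have zAB : @tor_cycle k n P (monI k (A `&` B)) i j (dif P i *m a).
  split; last by case: (i) (a) => //= i' a'; rewrite dif_dif.
  apply: tor_chainI; first exact: tor_chain_dif.
  by rewrite eab; apply/tor_chainN/tor_chain_dif.
have [|c hc ec] := rAB i j _ _ zAB; first by lia.
(* Correcting by [c], which lies over both ideals, turns the two parts into cycles. *)
have -> : v = (a - c) + (b + c) by rewrite e addrACA addNr addr0.
apply: bd; split.
- by apply: tor_chainD => //; apply/tor_chainN/(tor_chainS _ hc) => x [].
- by rewrite /= mulmxBr ec subrr.
- by apply: tor_chainD => //; apply/(tor_chainS _ hc) => x [].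
- by rewrite /= mulmxDr ec eab addrN.
Qed.

(** Mayer-Vietoris again: if a cycle over [A] bounds [a + b] over the sum, subtracting the boundary
    of [a] leaves the boundary of [b], a cycle over the intersection. *)
Lemma reg_leIU A B d : upclosed A -> upclosed B ->
  reg_le (A `&` B) d -> reg_le (A `|` B) d -> reg_le A d.
Proof.
move=> hA hB rI rU i j lt v zv.
have sA : (A `<=` A `|` B) by move=> x; left.
have sI : (A `&` B `<=` A) by move=> x [].
have cv : @tor_chain k n P (monI k A) i j v by case: zv.
have [w hw ew] : @tor_boundary k n P (monI k (A `|` B)) i j v.
  by apply: rU => //; case: zv => h1 h2; split => //; apply: tor_chainS h1.
have [a [b [ha hb e]]] := tor_chain_split hw.
have eb : v - dif P i *m a = dif P i *m b by rewrite -ew e mulmxDr addrC addKr.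
have [c hc ec] : @tor_boundary k n P (monI k (A `&` B)) i j (v - dif P i *m a).
  apply: rI => //; split.
    apply: tor_chainI; last by rewrite eb; apply: tor_chain_dif.
    by apply: tor_chainD => //; apply/tor_chainN/tor_chain_dif.
  rewrite eb; clear; case: (i) b => //= i' b; exact: dif_dif.
exists (a + c); first by apply: tor_chainD => //; apply: tor_chainS hc.
by rewrite mulmxDr ec addrC subrK.
Qed.

(** If [M] belongs to an ideal I, the two sets belong to (I : x_t) and x_t (I : x_t); multiplication
    by x_t identifies them and raises degrees by one. *)
Lemma reg_le_shift t M d : reg_le [set m : mon | M (m + U_(t))%MM] d ->
  reg_le [set m : mon | (0 < m t)%N /\ M m] (d + 1).
Proof.
move=> h i j lt v zv; have cv := zv.1; move: (cv) => [v1 v2].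
pose v' := map_mx (mquot t) v.
have ev : v = 'X_t *: v'.
  apply/matrixP => a b; rewrite !mxE ord1 -mulX_mquot // => m hm.
  by have [] := v1 a m hm.
have [w [w1 w2] ew] :
    @tor_boundary k n P (monI k [set m : mon | M (m + U_(t))%MM]) i (j - 1) v'.
  apply: h; first by lia.
  split.
    split=> a m; rewrite mxE => /msupp_mquot hm; first by have [] := v1 _ _ hm.
    by have := v2 _ _ hm; rewrite mdegD mdeg1; lia.
  move: v' ev zv.2 => {cv v1 v2 zv lt}; case: i v => [//|i] v v' ->.
  rewrite /= -scalemxAr => e.
  apply/matrixP => a b; have /matrixP/(_ a b) := e; rewrite !mxE => /eqP.
  by rewrite mulf_eq0 mpolyX_eq0 /= => /eqP.
exists ('X_t *: w); last by rewrite -scalemxAr ew ev.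
split=> a m; rewrite mxE => /msuppM_le /allpairsP[[m1 m2] /= [+ h2 ->]].
  rewrite msuppX inE => /eqP ->; split; first by rewrite mnmDE mnm1E eqxx.
  by rewrite addmC; exact: w1 h2.
by rewrite msuppX inE => /eqP ->; have := w2 _ _ h2; rewrite mdegD mdeg1; lia.
Qed.

Lemma reg_le_set0 d : reg_le set0 d.
Proof.
move=> i j _ v [[v1 _] _]; exists 0.
  by split=> a m; rewrite mxE msupp0.
rewrite mulmx0; apply/matrixP => a b; rewrite !mxE ord1.
by apply/mpolyP => m; rewrite mcoeff0; apply/esym/memN_msupp_eq0/negP => /v1.
Qed.

Lemma reg_le_setT : reg_le setT 0.
Proof.
move=> i j lt v [[_ v2] zv].
have [w ew] : exists w, v = dif P i *m w.
  case: i lt v v2 zv => [|i] lt v v2 zv; last exact/exact_S.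
  (* Here [0 < j], so [v] has no constant term at a basis vector of degree 0. *)
  apply/exact_0/big1 => a _; case: (eqVneq (aug a) 0) => [->|/aug_homog d0].
    by rewrite mulr0.
  suff -> : (v a ord0)@_0%MM = 0 by rewrite mul0r.
  by apply/memN_msupp_eq0/negP => /v2; rewrite mdeg0 d0; lia.
(* The preimage from exactness need not be homogeneous. The image of its part outside degree [j] has
   no monomial in degree [j], whereas [v] and the image of [w'] have no others. *)
pose w' := \col_c mpart [set m : mon | (mdeg m)%:Z + deg c = j] (w c ord0).
exists w'; first by split=> c m; rewrite mxE => /msupp_mpart[].
rewrite ew; apply/matrixP => a b; rewrite ord1 {b}.
apply/mpolyP => m; have hd c := @dif_homog _ _ P i c a.
apply/eqP; rewrite -subr_eq0 -mcoeffB.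
have -> : (dif P i *m w') a ord0 - (dif P i *m w) a ord0 =
   (dif P i *m (w' - w)) a ord0 by rewrite mulmxBr !mxE.
have sw c m2 : m2 \in msupp ((w' - w) c ord0) -> (mdeg m2)%:Z + deg c != j.
  rewrite !mxE mcoeff_msupp mcoeffB mcoeff_mpart.
  by case: asboolP => /= [_|/eqP //]; rewrite subrr eqxx.
rewrite -[_ == 0]negbK -mcoeff_msupp; apply/negP => hm.
have [c [m1 [m2 [h1 h2 e]]]] := msupp_mulmx hm.
have hmj : (mdeg m)%:Z + deg a <> j.
  have := sw _ _ h2; have := hd c m1; rewrite !mxE => /(_ h1).
  rewrite e mdegD; lia.
move: hm; rewrite mulmxBr mxE [(- (_ *m _)) a _]mxE mcoeff_msupp mcoeffB -ew.
rewrite (memN_msupp_eq0 (p := v a ord0)) ?subr0; last first.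
  by apply/negP => /v2.
rewrite -mcoeff_msupp => /msupp_mulmx[c' [n1 [n2 [g1 g2 e']]]].
have := hd c' n1; rewrite !mxE => /(_ g1).
move: g2; rewrite mxE => /msupp_mpart[_ /=]; move: hmj; rewrite e' mdegD; lia.
Qed.

End TorVanishing.

(** * Elimination orderings and upper bounds *)

Section Elimination.
Variables (T : finType) (adj : rel T).

(** The index bounds how often one may pass to the non-neighbours of a vertex. In [elim 1] these
    must form a clique of the complement, which is a perfect elimination ordering there. *)
Inductive elim : nat -> {set T} -> Prop :=
| elim_indep d (U : {set T}) : {in U &, forall x y, ~~ adj x y} -> elim d U
| elim_step d (U : {set T}) x : x \in U ->
    elim d (finset (fun y => [&& y \in U, y != x & ~~ adj x y])) ->
    elim d.+1 (U :\ x) -> elim d.+1 U.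

Lemma elimS d (U : {set T}) : elim d U -> elim d.+1 U.
Proof.
elim=> {d U} [d U ind|d U x xU _ IH1 _ IH2]; first exact: elim_indep.
exact: elim_step xU IH1 IH2.
Qed.

(** The vertices of [A] are removed by decreasing [rho]; [U'] is what is present when [x] is
    removed. *)
Lemma elim_order d (rho : T -> int) (U A : {set T}) : A \subset U ->
  (forall x (U' : {set T}), x \in A -> x \in U' -> U :\: A \subset U' ->
     U' \subset U -> (forall y, y \in U' -> y \in A -> rho y <= rho x) ->
     elim d (finset (fun y => [&& y \in U', y != x & ~~ adj x y]))) ->
  elim d.+1 (U :\: A) -> elim d.+1 U.
Proof.
have [p] := ubnP #|A|; elim: p => // p IH in U A * => cA sAU step base.
have [A0|[x0 x0A]] := finset.set_0Vmem A; first by rewrite A0 finset.setD0 in base.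
have [x xA0 max] := Order.TotalTheory.arg_maxP (P := mem A) rho x0A.
have xA : x \in A := xA0.
have xU := fintype.subsetP sAU _ xA.
apply: (elim_step xU).
  by apply: step => //; [exact: finset.subsetDl|move=> y _ /max].
apply: (IH _ (A :\ x)).
- by move: cA; rewrite (cardsD1 x) xA; lia.
- exact: finset.setSD.
- move=> z U' /finset.setD1P[zx zA] zU' sU' sU'' mx; apply: step => //.
  + apply: fintype.subset_trans sU'; apply/fintype.subsetP => y; rewrite !inE => /andP[yA yU].
    by rewrite yU (negPf yA) andbF andbT /=; apply: contraNneq yA => ->.
  + by apply: fintype.subset_trans sU'' (finset.subsetDl _ _).
  + move=> y yU' yA; apply: mx => //; rewrite !inE yA andbT.
    by have /fintype.subsetP/(_ _ yU') := sU''; rewrite !inE => /andP[].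
- apply: eq_ind base _ _; apply/finset.setP => y; rewrite !inE.
  by case: eqVneq => [->|_] //=; rewrite xA.
Qed.

(* The complement is an interval graph: eliminating the vertices by increasing
   right end point, the remaining intervals that meet the current one all
   contain its right end point. *)
Lemma elim_interval (lft rgt : T -> int) (U : {set T}) :
  {in U &, forall x y, ~~ adj x y = (lft x <= rgt y) && (lft y <= rgt x)} ->
  elim 1 U.
Proof.
move=> h; apply: (elim_order (rho := fun x => - rgt x) (A := U)) => //.
  move=> x U' xU xU' _ sU min; apply: elim_indep => y z.
  rewrite !inE => /and3P[yU' yx xy] /and3P[zU' zx xz].
  have [yU zU] : y \in U /\ z \in U by split; apply: (fintype.subsetP sU).
  have := min y yU' yU; have := min z zU' zU => ez ey.
  by move: xy xz; rewrite !h //; lia.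
by rewrite finset.setDv; apply: elim_indep => x y; rewrite inE.
Qed.

End Elimination.

(** * Upper bounds for edge ideals *)

Section EdgeIdeals.
Variables (k : fieldType) (n : nat) (adj : rel 'I_n).
Hypotheses (adj_sym : ssrbool.symmetric adj) (adj_irr : irreflexive adj).
Local Notation mon := 'X_{1..n}.

(** The ring keeps all variables when [U] shrinks, so one resolution [P] serves all induced
    subgraphs. *)
Definition edgeM (U : {set 'I_n}) : set mon :=
  [set m : mon | exists x y, [/\ x \in U, y \in U, adj x y, (0 < m x)%N & (0 < m y)%N]].

Definition varM (s : seq 'I_n) : set mon :=
  [set m : mon | exists2 w, w \in s & (0 < m w)%N].

Lemma edgeM_upclosed U : upclosed (edgeM U).
Proof.
move=> m m' [x [y [xU yU xy mx my]]]; exists x, y; split=> //; rewrite mnmDE; lia.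
Qed.

Lemma varM_upclosed s : upclosed (varM s).
Proof. by move=> m m' [w ws mw]; exists w => //; rewrite mnmDE; lia. Qed.

Lemma upclosedU (A B : set mon) : upclosed A -> upclosed B -> upclosed (A `|` B).
Proof. by move=> hA hB m m' [/hA|/hB] h; [left|right]. Qed.

Variable P : resolution_k k n.

Lemma varM1 t : varM [:: t] = [set m : mon | (0 < m t)%N /\ setT m].
Proof.
apply/seteqP; split=> m; first by move=> [w]; rewrite inE => /eqP ->.
by move=> [h _]; exists t; rewrite ?inE.
Qed.

Lemma reg_le_var t : reg_le P (varM [:: t]) 1.
Proof. by rewrite varM1; apply: (@reg_le_shift _ _ P t setT 0); exact: reg_le_setT. Qed.

(** As [t] does not occur in minimal generators of [M], the intersection with (x_t) is x_t times the
    ideal and has the bound [d + 1] that Mayer-Vietoris asks for. *)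
Lemma reg_leU_var t M d : upclosed M -> (forall m : mon, M (m + U_(t))%MM -> M m) ->
  1 <= d -> reg_le P M d -> reg_le P (M `|` varM [:: t]) d.
Proof.
move=> hM ht d1 rM; apply: reg_leU => //; first exact: varM_upclosed.
  by apply: reg_leW d1 _; exact: reg_le_var.
have -> : M `&` varM [:: t] = [set m : mon | (0 < m t)%N /\ M m].
  by rewrite varM1; apply/seteqP; split=> m /= [] => [? [] //|? ?].
apply: reg_le_shift; have -> // : [set m : mon | M (m + U_(t))%MM] = M.
apply/seteqP; split=> m; first exact: ht.
by move=> h; rewrite /= addmC; apply: hM.
Qed.

Lemma reg_leU_vars (U : {set 'I_n}) s d : uniq s -> {in s, forall t, t \notin U} -> 1 <= d ->
  reg_le P (edgeM U) d -> reg_le P (edgeM U `|` varM s) d.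
Proof.
move=> + + d1 rU; elim: s => [|t s IH] /=.
  move=> _ _; have -> // : edgeM U `|` varM [::] = edgeM U.
  by apply/seteqP; split=> m; [case=> // -[]|left].
move=> /andP[ts us] sU; have -> : varM (t :: s) = varM s `|` varM [:: t].
  apply/seteqP; split=> m.
    move=> [w]; rewrite inE => /orP[/eqP->|ws] mw; last by left; exists w.
    by right; exists t; rewrite ?inE.
  by move=> [] [w] ws mw; exists w => //; move: ws; rewrite !inE ?orbF => ->; rewrite ?orbT.
rewrite setUA; apply: reg_leU_var => //.
- by apply: upclosedU; [exact: edgeM_upclosed|exact: varM_upclosed].
- have tU : t \notin U by apply: sU; rewrite inE eqxx.
  have hz z (m : mon) : z != t -> (m + U_(t))%MM z = m z.
    by move=> zt; rewrite mnmDE mnm1E eq_sym (negPf zt) addn0.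
  move=> m [[x [y [xU yU xy mx my]]]|[w ws mw]].
    left; exists x, y; split=> //.
      by rewrite hz // in mx; apply: contraNneq tU => <-.
    by rewrite hz // in my; apply: contraNneq tU => <-.
  by right; exists w => //; rewrite hz // in mw; apply: contraNneq ts => <-.
- by apply: IH => // z zs; apply: sU; rewrite inE zs orbT.
Qed.

Lemma elim_reg_le d U : elim adj d U -> reg_le P (edgeM U) d.+1%:Z.
Proof.
elim=> {d U} [d U ind|d U x xU _ IH1 _ IH2].
  suff -> : edgeM U = set0 by exact: reg_le_set0.
  by apply/seteqP; split=> m // [a [b [aU bU ab _ _]]]; move: (ind a b aU bU); rewrite ab.
have upE := @edgeM_upclosed; have upx := @varM_upclosed [:: x].
apply: (@reg_leIU _ _ P _ (varM [:: x])) => //; last first.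
  (* Once the variable [x] is added, the edges at [x] are redundant. *)
  have -> : edgeM U `|` varM [:: x] = edgeM (U :\ x) `|` varM [:: x].
    apply/seteqP; split=> m [] h; try by right.
      move: h => [a [b [aU bU ab ma mb]]].
      have [ax|nax] := eqVneq a x; first by right; exists a; rewrite ?ax ?inE // -ax.
      have [bx|nbx] := eqVneq b x; first by right; exists b; rewrite ?bx ?inE // -bx.
      by left; exists a, b; rewrite !inE nax nbx.
    move: h => [a [b []]]; rewrite !inE => /andP[_ aU] /andP[_ bU] *.
    by left; exists a, b.
  apply: reg_leU_vars => //.
  by move=> t; rewrite !inE => /eqP ->; rewrite eqxx.
have -> : edgeM U `&` varM [:: x] = [set m : mon | (0 < m x)%N /\ edgeM U m].
  by rewrite varM1; apply/seteqP; split=> m /= [] => [? [] //|? ?].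
have -> : d.+2%:Z = d.+1%:Z + 1 by lia.
apply: reg_le_shift; set V := finset _ in IH1.
set s := [seq y <- enum U | adj x y].
(* The colon ideal by [x] is generated by the neighbours of [x] and the edges avoiding [x] and its
   neighbours. *)
have -> : [set m : mon | edgeM U (m + U_(x))%MM] = edgeM V `|` varM s.
  apply/seteqP; split=> m.
    move=> [a [b [aU bU ab]]]; rewrite !mnmDE !mnm1E => ma mb.
    have [xa|nxa] := boolP (adj x a).
      right; exists a; first by rewrite mem_filter xa mem_enum.
      by move: ma; case: eqP => [e|]; [move: xa; rewrite e adj_irr|lia].
    have [xb|nxb] := boolP (adj x b).
      right; exists b; first by rewrite mem_filter xb mem_enum.
      by move: mb; case: eqP => [e|]; [move: xb; rewrite e adj_irr|lia].
    have nax : a != x by apply: contraNneq nxb => <-.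
    have nbx : b != x by apply: contraNneq nxa => <-; rewrite adj_sym.
    left; exists a, b; rewrite !inE aU bU nax nbx nxa nxb; split=> //.
      by move: ma; rewrite eq_sym (negPf nax) addn0.
    by move: mb; rewrite eq_sym (negPf nbx) addn0.
  move=> [[a [b []]]|[w]].
    rewrite !inE => /and3P[aU _ _] /and3P[bU _ _] ab ma mb.
    by exists a, b; rewrite !mnmDE; split=> //; lia.
  rewrite mem_filter mem_enum => /andP[xw wU] mw; exists x, w.
  by rewrite !mnmDE mnm1E eqxx; split=> //; lia.
apply: reg_leU_vars => //; first exact/filter_uniq/enum_uniq.
by move=> t; rewrite mem_filter !inE => /andP[-> _]; rewrite !andbF.
Qed.

End EdgeIdeals.

(** * The Koszul complex and lower bounds *)

Section Signs.
Variables (R : comNzRingType) (n : nat).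
Implicit Types (F : {set 'I_n}) (s t : 'I_n).

(** The sign of sorting [t] into the increasing exterior product indexed by [F]. *)
Definition ksign t F : R := (-1) ^+ #|finset (fun u : 'I_n => (u \in F) && (u < t)%N)|.

Lemma ksignK t F : ksign t F * ksign t F = 1.
Proof. by rewrite /ksign -expr2 sqrr_sign. Qed.

Lemma ksignU1 s t F : s \notin F ->
  ksign t (s |: F) = (-1) ^+ (s < t)%N * ksign t F.
Proof.
move=> sF; rewrite /ksign -exprD; congr (_ ^+ _).
rewrite (cardsD1 s) !inE eqxx /= (_ : _ :\ s = finset (fun u => (u \in F) && (u < t)%N)) //.
apply/finset.setP => u; rewrite !inE; case: eqVneq => //= ->.
by rewrite (negPf sF).
Qed.

Lemma ksignU1id t F : ksign t (t |: F) = ksign t F.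
Proof.
rewrite /ksign; congr (_ ^+ _); apply: eq_card => u; rewrite !inE.
by case: eqVneq => //= ->; rewrite ltnn andbF.
Qed.

Lemma ksignD1id t F : ksign t (F :\ t) = ksign t F.
Proof.
rewrite /ksign; congr (_ ^+ _); apply: eq_card => u; rewrite !inE.
by case: eqVneq => //= ->; rewrite ltnn andbF.
Qed.

Lemma ksign_anticomm s t F : s != t -> s \notin F -> t \notin F ->
  ksign t F * ksign s (t |: F) = - (ksign s F * ksign t (s |: F)).
Proof.
move=> st sF tF; rewrite !ksignU1 // mulrCA mulrA [ksign s F * _]mulrCA -mulrA.
rewrite [ksign s F * _]mulrC -mulNr; congr (_ * _).
have : val s != val t by [].
by case: ltngtP => //= _ _; rewrite ?expr0 ?expr1 ?opprK.
Qed.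

Lemma ksign_swap s t F : s != t -> s \notin F -> t \notin F ->
  ksign s (t |: F) * ksign t (s |: F) = - (ksign t F * ksign s F).
Proof.
move=> st sF tF; rewrite !ksignU1 //.
have : val s != val t by [].
by case: ltngtP => //= _ _; rewrite ?expr0 ?expr1; ring.
Qed.

End Signs.

Arguments ksign {R n} t F.
Arguments ksignU1id {R n} t F.
Arguments ksignD1id {R n} t F.
Arguments ksign_anticomm {R n s t F}.
Arguments ksign_swap {R n s t F}.

(** * The Koszul resolution of the residue field *)

Section Koszul.
Variables (k : fieldType) (n : nat).
Local Notation S := {mpoly k[n]}.
Local Notation mon := 'X_{1..n}.
Implicit Types (F G : {set 'I_n}) (f g : {set 'I_n} -> S) (s t : 'I_n).

(** A function [f] stands for the sum of the f(G) e_G over all subsets, all homological degrees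
    together; this is the coefficient of its Koszul boundary at e_F. *)
Definition kdiff f F : S := \sum_(t | t \notin F) ksign t F * 'X_t * f (t |: F).

Lemma kdiffB f g F : kdiff (fun G => f G - g G) F = kdiff f F - kdiff g F.
Proof. by rewrite /kdiff -sumrB; apply: eq_bigr => t _; rewrite mulrBr. Qed.

Lemma kdiffD f g F : kdiff (fun G => f G + g G) F = kdiff f F + kdiff g F.
Proof. by rewrite /kdiff -big_split; apply: eq_bigr => t _; rewrite mulrDr. Qed.

Lemma eq_kdiff f g F : (forall t, t \notin F -> f (t |: F) = g (t |: F)) ->
  kdiff f F = kdiff g F.
Proof. by rewrite /kdiff => h; apply: eq_bigr => t tF; rewrite h. Qed.

Lemma kdiff_kdiff f F : kdiff (kdiff f) F = 0.
Proof.
pose A t s := ksign t F * 'X_t * (ksign s (t |: F) * 'X_s * f (s |: (t |: F))).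
have -> : kdiff (kdiff f) F =
    \sum_(t | t \notin F) \sum_(s | s \notin F) (if s == t then 0 else A t s).
  rewrite {1}/kdiff; apply: eq_bigr => t tF; rewrite /kdiff mulr_sumr.
  rewrite [RHS]big_mkcond [LHS]big_mkcond /=.
  by apply: eq_bigr => s _; rewrite !inE negb_or; case: eqP => //=; case: ifP.
(* The sum is cut along the order of [s] and [t], as the two orders of insertion cancel. *)
have -> : \sum_(t | t \notin F) \sum_(s | s \notin F) (if s == t then 0 else A t s) =
  \sum_(t | t \notin F) \sum_(s | s \notin F) (if (s < t)%N then A t s else 0) +
  \sum_(t | t \notin F) \sum_(s | s \notin F) (if (t < s)%N then A t s else 0).
  rewrite -big_split; apply: eq_bigr => t _; rewrite -big_split; apply: eq_bigr => s _ /=.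
  rewrite -(inj_eq val_inj) /=.
  by case: ltngtP; rewrite ?addr0 ?add0r.
rewrite [X in _ + X]exchange_big -big_split big1 //= => t tF.
rewrite -big_split big1 //= => s sF; case: ifP => [lt|_]; last by rewrite addr0.
have ne : s != t by rewrite -(inj_eq val_inj) /= neq_ltn lt.
rewrite /A (finset.setUCA [set s]%SET [set t]%SET F).
set x := f _; rewrite -[_ * 'X_t * _]mulrACA mulrA [X in X + _](_ : _ =
  (ksign t F * ksign s (t |: F)) * ('X_t * ('X_s * x))); last by ring.
rewrite ksign_anticomm //; ring.
Qed.

(* Contracting homotopy for the variable [t]: it inverts multiplication by
   ['X_t] on the part divisible by ['X_t]. *)
Definition kcontr t f F : S :=
  if t \in F then ksign t F * mquot t (f (F :\ t)) else 0.

(** What the homotopy leaves: the terms with [t] neither in the basis element nor in the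
    monomial. *)
Definition kproj t f F : S :=
  if t \in F then 0 else mpart [set m : mon | m t = 0%N] (f F).

Lemma mquot_mulX t (p : S) : mquot t ('X_t * p) = p.
Proof.
apply/mpolyP => m; rewrite mcoeff_mquot mcoeffXU_mul mnmDE mnm1E eqxx addn1 /=.
by rewrite addmK.
Qed.

Lemma mquot_mulXne s t (p : S) : s != t -> mquot t ('X_s * p) = 'X_s * mquot t p.
Proof.
move=> st; apply/mpolyP => m; rewrite !(mcoeff_mquot, mcoeffXU_mul).
rewrite mnmDE mnm1E eq_sym (negPf st) addn0; case: ifP => // ms.
congr (_@_ _); apply/mnmP => i; rewrite !(mnmBE, mnmDE, mnm1E).
by case: (eqVneq s i) => [<-|_]; rewrite ?(eq_sym t s) ?(negPf st); lia.
Qed.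

Lemma mquotD t (p q : S) : mquot t (p + q) = mquot t p + mquot t q.
Proof. by apply/mpolyP => m; rewrite !(mcoeffD, mcoeff_mquot). Qed.

Lemma mquot0 t : mquot t (0 : S) = 0.
Proof. by apply/mpolyP => m; rewrite !(mcoeff0, mcoeff_mquot). Qed.

Lemma mquot_ksign t s F (p : S) : mquot t (ksign s F * p) = ksign s F * mquot t p.
Proof.
apply/mpolyP => m; rewrite /ksign -signr_odd; case: odd; rewrite ?expr1 ?expr0 !(mulN1r, mul1r).
  by rewrite mcoeffN !mcoeff_mquot mcoeffN.
by [].
Qed.

Lemma mulX_mquot_mpart t (p : S) :
  'X_t * mquot t p = p - mpart [set m : mon | m t = 0%N] p.
Proof.
apply/mpolyP => m; rewrite mcoeffXU_mul mcoeffB mcoeff_mpart mcoeff_mquot.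
case: asboolP => /= h; first by rewrite h ltnn subrr.
have h' : (0 < m t)%N by lia.
rewrite h' subr0 submK //; apply/mnm_lepP => i; rewrite mnm1E.
by case: eqP => // <-.
Qed.

(** If [t] lies in [F], the summand [t] of [kdiff f] gives [f F] and the others cancel by
    [ksign_swap]. If not, only the summand [t] of the outer [kdiff] survives. *)
Lemma kdiff_kcontr t f F :
  kdiff (kcontr t f) F + kcontr t (kdiff f) F = f F - kproj t f F.
Proof.
rewrite /kproj {2}/kcontr; have [tF|tF] := boolP (t \in F).
  rewrite subr0; have eF := finset.setD1K tF.
  have tG : t \notin F :\ t by rewrite !inE eqxx.
  rewrite {2}/kdiff (bigD1 t) //= mquotD eF mulrDr.
  have -> : ksign t F * mquot t (ksign t (F :\ t) * 'X_t * f F) = f F.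
    by rewrite -mulrA mquot_ksign mquot_mulX ksignD1id mulrA ksignK mul1r.
  rewrite addrCA -[RHS]addr0; congr (_ + _).
  rewrite (big_morph _ (mquotD t) (mquot0 t)) mulr_sumr.
  rewrite [X in _ + X](eq_bigl (fun s => s \notin F)); last first.
    move=> s; rewrite !inE; case: (eqVneq s t) => [->|]; last by rewrite andbT.
    by rewrite tF.
  rewrite /kdiff -big_split big1 //= => s sF.
  have st : s != t by apply: contraNneq sF => ->.
  rewrite /kcontr !inE tF orbT.
  have -> : (s |: F) :\ t = s |: F :\ t.
    apply/finset.setP => u; rewrite !inE; case: (eqVneq u s) => [->|] //=.
    by rewrite st.
  rewrite -[_ * 'X_s * f _]mulrA mquot_ksign mquot_mulXne //; set x := mquot _ _.
  have sG : s \notin F :\ t by rewrite !inE negb_and sF orbT.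
  have := @ksign_swap S _ _ _ _ st sG tG; rewrite eF.
  have -> : ksign t (s |: F :\ t) = ksign t (s |: F) :> S.
    by rewrite -(ksignD1id t (s |: F)); congr ksign; apply/finset.setP => u;
      rewrite !inE; case: (eqVneq u t) => //= ->; rewrite eq_sym (negPf st).
  rewrite ksignD1id => e.
  rewrite (_ : _ + _ = (ksign s F * ksign t (s |: F) +
    ksign t F * ksign s (F :\ t)) * ('X_s * x)); last by ring.
  by rewrite e addNr mul0r.
rewrite addr0 /kdiff (bigD1 t) //= big1 ?addr0 => [|s /andP[sF st]]; last first.
  by rewrite /kcontr !inE eq_sym (negPf st) (negPf tF) mulr0.
rewrite /kcontr !inE eqxx /= ksignU1id mulrACA ksignK mul1r finset.setU1K //.
exact: mulX_mquot_mpart.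
Qed.

Lemma mcoeff_ksign t F (p : S) m : (ksign t F * p)@_m = ksign t F * p@_m.
Proof. by rewrite -mcoeffCM rmorphXn rmorphN1. Qed.

Lemma msupp_ksignXM t F (p : S) m : m \in msupp (ksign t F * 'X_t * p) ->
  (0 < m t)%N /\ (m - U_(t))%MM \in msupp p.
Proof.
rewrite -mulrA !mcoeff_msupp mcoeff_ksign mulf_eq0 signr_eq0 mcoeffXU_mul /=.
by case: ifP => //; rewrite eqxx.
Qed.

Lemma mcoeff_kdiff0 f F : (kdiff f F)@_0%MM = 0.
Proof.
rewrite raddf_sum big1 //= => t _; apply/memN_msupp_eq0/negP => /msupp_ksignXM[].
by rewrite mnm0E.
Qed.

(** The homotopies are applied one variable after the other; [kproj] for a new variable keeps what
    was achieved for the earlier ones. *)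
Lemma kdiff_homotopic_seq f (l : seq 'I_n) : (forall F, kdiff f F = 0) ->
  exists g f', [/\ forall F, f F = kdiff g F + f' F, forall F, kdiff f' F = 0 &
    {in l, forall t F, (t \in F -> f' F = 0) /\
      forall m, m \in msupp (f' F) -> m t = 0%N}].
Proof.
move=> f0; elim: l => [|s l [g [f' [e z h]]]].
  exists (fun _ => 0), f; split => // F.
  by rewrite /kdiff big1 ?add0r // => t _; rewrite mulr0.
have eF F : f' F = kdiff (kcontr s f') F + kproj s f' F.
  have := kdiff_kcontr s f' F; rewrite {2}/kcontr z mquot0 mulr0 if_same addr0.
  by move=> ->; rewrite subrK.
exists (fun F => g F + kcontr s f' F), (kproj s f'); split.
- by move=> F; rewrite kdiffD e eF addrA.
- move=> F; have -> : kproj s f' = fun G => f' G - kdiff (kcontr s f') G.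
    by apply/funext => G; rewrite {1}eF addrC addKr.
  by rewrite kdiffB z kdiff_kdiff subrr.
- move=> t; rewrite inE => /predU1P[->|tl] F; rewrite /kproj.
    split=> [->//|m]; case: ifP => _; first by rewrite msupp0.
    by move=> /msupp_mpart[].
  have [h1 h2] := h t tl F; split=> [/h1 ->|m].
    case: ifP => // _; apply/mpolyP => m; rewrite mcoeff_mpart mcoeff0.
    by rewrite if_same.
  by case: ifP => _; [rewrite msupp0|move=> /msupp_mpart[/h2]].
Qed.

(** With all variables projected away only a constant at the empty set is left; it is that of [f],
    as boundaries have no constant term. *)
Lemma kdiff_exact f : (forall F, kdiff f F = 0) -> exists g, forall F,
  f F = kdiff g F + (if F == finset.set0 then ((f finset.set0)@_0%MM)%:MP else 0).
Proof.
move=> /(@kdiff_homotopic_seq f (enum 'I_n))[g [f' [e _ h]]]; exists g => F.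
rewrite [LHS]e; congr (_ + _); case: ifP => [/eqP ->|/negbT /set0Pn[t tF]]; last first.
  by have [->] := h t (mem_enum _ _) F.
rewrite e mcoeffD mcoeff_kdiff0 add0r; apply/mpolyP => m; rewrite mcoeffC.
case: eqVneq => [<-|m0]; first by rewrite mulr1.
rewrite mulr0; apply/memN_msupp_eq0/negP => hm; case/eqP: m0; apply/mnmP => t.
by have [_ ->] := h t (mem_enum _ _) finset.set0; rewrite ?mnm0E.
Qed.

Definition ksets (i : nat) : {set {set 'I_n}} := finset (fun F => #|F| == i).
Definition krk (i : nat) := #|ksets i|.

Definition kcol i f : 'cV[S]_(krk i) := \col_a f (enum_val a).
(** Extension by zero to subsets of other sizes, which makes [kdiff] applicable. *)
Definition kfun i (v : 'cV[S]_(krk i)) F : S := \sum_(a | enum_val a == F) v a ord0.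

Lemma card_ksets i (a : 'I_(krk i)) : #|enum_val a| = i.
Proof. by have := enum_valP a; rewrite inE => /eqP. Qed.

Lemma kfun_enum i (v : 'cV[S]_(krk i)) a : kfun v (enum_val a) = v a ord0.
Proof.
rewrite /kfun (bigD1 a) //= big1 ?addr0 // => b /andP[/eqP /enum_val_inj ->].
by rewrite eqxx.
Qed.

Lemma kfun_out i (v : 'cV[S]_(krk i)) F : #|F| != i -> kfun v F = 0.
Proof. by move=> h; rewrite /kfun big1 // => a /eqP e; move: h; rewrite -e card_ksets eqxx. Qed.

Lemma ksets_enum i F : #|F| = i -> exists a : 'I_(krk i), enum_val a = F.
Proof.
move=> e; have FK : F \in ksets i by rewrite inE e.
by exists (enum_rank_in FK F); rewrite enum_rankK_in.
Qed.

Lemma kfun_col i f F : #|F| = i -> kfun (kcol i f) F = f F.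
Proof. by move=> /ksets_enum[a <-]; rewrite kfun_enum mxE. Qed.

Lemma kcol_fun i (v : 'cV[S]_(krk i)) : kcol i (kfun v) = v.
Proof. by apply/matrixP => a b; rewrite mxE kfun_enum (ord1 b). Qed.

Definition kmx i : 'M[S]_(krk i, krk i.+1) := \matrix_(a < krk i, b < krk i.+1)
  \sum_(t | (t \notin enum_val a) && (t |: enum_val a == enum_val b))
    ksign t (enum_val a) * 'X_t.

Lemma kmx_mul i (v : 'cV[S]_(krk i.+1)) : kmx i *m v = kcol i (kdiff (kfun v)).
Proof.
apply/matrixP => a b; rewrite !mxE /kdiff ord1.
under eq_bigr => c _ do rewrite mxE mulr_suml big_mkcondr.
rewrite exchange_big; apply: eq_bigr => t _ /=.
rewrite mulr_sumr [RHS]big_mkcond; apply: eq_bigr => c _.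
by rewrite eq_sym; case: ifP.
Qed.

Lemma kmx_col i f : kmx i *m kcol i.+1 f = kcol i (kdiff f).
Proof.
rewrite kmx_mul; apply/matrixP => a b; rewrite !mxE; apply: eq_kdiff => t ta.
by rewrite kfun_col // cardsU1 ta card_ksets.
Qed.

Lemma kdiff_fun_out i (v : 'cV[S]_(krk i.+1)) F : #|F| != i -> kdiff (kfun v) F = 0.
Proof.
move=> h; rewrite /kdiff big1 // => t tF; rewrite kfun_out ?mulr0 //.
by rewrite cardsU1 tF.
Qed.

Lemma kcol_eq0 i f : kcol i f = 0 -> forall F, #|F| = i -> f F = 0.
Proof. by move=> /matrixP e F /ksets_enum[a <-]; have := e a ord0; rewrite !mxE. Qed.

Definition kaug (a : 'I_(krk 0)) : k := 1.

Lemma kmx_homog i c : homog_vec (fun _ : 'I_(krk i) => i%:Z) i.+1%:Z (col c (kmx i)).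
Proof.
move=> a m; rewrite !mxE => hm.
suff : mdeg m = 1%N by lia.
move: hm; apply: contraTeq => /eqP hm; rewrite mcoeff_msupp raddf_sum negbK big1 //=.
move=> t _; apply/memN_msupp_eq0/negP; rewrite -[ksign _ _ * _]mulr1.
move=> /msupp_ksignXM[mt]; rewrite msupp1 inE => /eqP e; apply: hm.
have -> : m = (m - U_(t) + U_(t))%MM.
  by rewrite submK //; apply/mnm_lepP => s; rewrite mnm1E; case: eqP => // <-.
by rewrite e mdegD mdeg0 mdeg1.
Qed.

Lemma kaug_homog (a : 'I_(krk 0)) : kaug a != 0 -> 0%:Z = 0. Proof. by []. Qed.

Lemma kaug_surj : exists a, kaug a != 0.
Proof.
have [a _] := ksets_enum (cards0 'I_n).
by exists a; exact: oner_neq0.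
Qed.

Lemma kmx_exact0 (v : 'cV[S]_(krk 0)) :
  \sum_a (v a ord0)@_0%MM * kaug a = 0 <-> exists w, v = kmx 0 *m w.
Proof.
have -> : \sum_a (v a ord0)@_0%MM * kaug a = (kfun v finset.set0)@_0%MM.
  rewrite /kfun raddf_sum [RHS]big_mkcond; apply: eq_bigr => a _ /=.
  by rewrite mulr1 -cards_eq0 card_ksets eqxx.
split=> [h|[w ->]]; last first.
  by rewrite kmx_mul kfun_col ?cards0 // mcoeff_kdiff0.
have [|g e] := @kdiff_exact (kfun v).
  move=> F; rewrite /kdiff big1 // => t tF; rewrite kfun_out ?mulr0 // cardsU1 tF; lia.
exists (kcol 1 g); rewrite kmx_col -[LHS]kcol_fun; apply/matrixP => a b.
by rewrite !mxE e h mpolyC0 if_same addr0.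
Qed.

Lemma kmx_exactS i (v : 'cV[S]_(krk i.+1)) :
  kmx i *m v = 0 <-> exists w, v = kmx i.+1 *m w.
Proof.
split=> [|[w ->]]; last first.
  rewrite [kmx i.+1 *m w]kmx_mul kmx_col; apply/matrixP => a b; rewrite !mxE.
  exact: kdiff_kdiff.
rewrite kmx_mul => /kcol_eq0 h; have [F|g e] := @kdiff_exact (kfun v).
  by have [/h|/kdiff_fun_out ->] := eqVneq #|F| i.
exists (kcol i.+2 g); rewrite kmx_col -[LHS]kcol_fun; apply/matrixP => a b.
by rewrite !mxE e -cards_eq0 card_ksets addr0.
Qed.

Lemma msuppXX (s t : 'I_n) (m : mon) : m \in msupp ('X_s * 'X_t : S) ->
  m = (U_(s) + U_(t))%MM.
Proof. by rewrite -mpolyXD msuppX inE => /eqP. Qed.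

Definition koszul : resolution_k k n :=
  @ResolutionK k n krk (fun i _ => i%:Z) kmx kaug kmx_homog kaug_homog kaug_surj
    kmx_exact0 kmx_exactS.

End Koszul.

(** * Nonvanishing Tor for edge ideals *)

Section LowerBounds.
Variables (k : fieldType) (n : nat) (adj : rel 'I_n).
Hypotheses (adj_sym : ssrbool.symmetric adj) (adj_irr : irreflexive adj).
Local Notation S := {mpoly k[n]}.
Local Notation mon := 'X_{1..n}.
Local Notation E := (monI k (edgeM adj finset.setT)).

Lemma edgeM_U x y (m : mon) : edgeM adj finset.setT m -> m = (U_(x) + U_(y))%MM -> adj x y.
Proof.
move=> [a [b [_ _ ab ma mb]]] e; move: ma mb; rewrite e !mnmDE !mnm1E.
rewrite !addn_gt0 !lt0b => /orP[] /eqP ea /orP[] /eqP eb; move: ab; rewrite -ea -eb ?adj_irr //.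
by rewrite adj_sym.
Qed.

Lemma Tor0_neq0 x y : adj x y -> Tor_neq0 E 0 2.
Proof.
move=> xy; exists (koszul k n) => sub.
pose f (F : {set 'I_n}) : S := 'X_x * 'X_y.
have [|w [w1 w2]] := sub (kcol 0 f).
  split=> //; split=> a m; rewrite mxE => /msuppXX ->.
    by exists x, y; rewrite !inE !mnmDE !mnm1E !eqxx; split=> //; lia.
  by rewrite mdegD !mdeg1.
(* The entries of [w] would have degree 1, where the ideal is zero. *)
have -> : w = 0.
  apply/matrixP => a b; rewrite mxE ord1; apply/mpolyP => m; rewrite mcoeff0.
  apply/memN_msupp_eq0/negP => hm; have := w2 a m hm => /= dm.
  have {dm} d1 : mdeg m = 1%N by lia.
  have [c [d [_ _ cd mc md]]] := w1 a m hm.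
  have cd' : d != c by apply: contraTneq cd => ->; rewrite adj_irr.
  by move: d1; rewrite mdegE (bigD1 c) // (bigD1 d) //=; lia.
rewrite mulmx0 => e; have := esym e => /kcol_eq0/(_ finset.set0 (cards0 _))/eqP.
by rewrite /f -mpolyXD mpolyX_eq0.
Qed.

(* The hypotheses say that the non-edge [uv] lies on a cycle of non-edges inside
   [s], but on no triangle of them. Connectedness of [u] and [v] by the other
   non-edges is expressed through functions constant along these. *)
Lemma Tor_cycle_neq0 (s : {set 'I_n}) u v i : #|s| = i.+3 -> u \in s -> v \in s ->
  u != v -> ~~ adj u v ->
  (forall t, t \in s -> t != u -> t != v -> adj u t || adj v t) ->
  (forall c : 'I_n -> k, (forall x y, x \in s -> y \in s -> x != y -> ~~ adj x y ->
     (x, y) != (u, v) -> (x, y) != (v, u) -> c x = c y) -> c u = c v) ->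
  Tor_neq0 E i i.+3%:Z.
Proof.
move=> cs us vs uv nuv tri conn; exists (koszul k n) => sub.
have cD x y : x \in s -> y \in s -> x != y -> #|s :\ x :\ y| = i.+1.
  move=> xs ys xy; have := cardsD1 x s; have := cardsD1 y (s :\ x).
  by rewrite !inE eq_sym xy xs ys; lia.
pose F0 := s :\ u :\ v.
(* This element is not over the ideal, but its boundary is: by [tri] each term x_u x_v x_t contains
   an edge at [t]. *)
pose f0 (F : {set 'I_n}) : S := if F == F0 then 'X_u * 'X_v else 0.
have f0_out (F : {set 'I_n}) : #|F| != i.+1 -> f0 F = 0.
  by rewrite /f0; case: (F =P F0) => // ->; rewrite cD // eqxx.
have [|w [w1 w2] ew] := sub (kcol i (kdiff f0)).
  split; last first.
    case: (i) => //= i'; rewrite kmx_col; apply/matrixP => a b; rewrite !mxE.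
    exact: kdiff_kdiff.
  have supp (F : {set 'I_n}) m : m \in msupp (kdiff f0 F) ->
      edgeM adj finset.setT m /\ mdeg m = 3%N.
    apply: contraTP => hm; rewrite mcoeff_msupp raddf_sum negbK big1 //= => t tF.
    apply/memN_msupp_eq0/negP => /msupp_ksignXM[mt]; rewrite /f0.
    case: eqP => [e|_]; last by rewrite msupp0.
    move=> /msuppXX e2; apply: hm.
    have em : m = (U_(u) + U_(v) + U_(t))%MM.
      rewrite -e2 submK //; apply/mnm_lepP => x; rewrite mnm1E; by case: eqP => // <-.
    have : t \in F0 by rewrite -e !inE eqxx.
    rewrite !inE => /and3P[tv tu ts].
    split; last by rewrite em !mdegD !mdeg1.
    have [mu mv] : (0 < m u)%N /\ (0 < m v)%N.
      by rewrite em !mnmDE !addn_gt0 !mnm1E !eqxx !orbT.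
    by case/orP: (tri t ts tu tv) => h; [exists u, t|exists v, t]; rewrite !inE.
  split=> a m; rewrite mxE => /supp[h1 h2] //; rewrite h2 /=; lia.
move/esym/eqP: ew; rewrite /= kmx_mul -subr_eq0 => /eqP ew.
(* If the boundary came from [w] over the ideal, [f0 - w] would be a cycle, hence the boundary of
   some [g]. *)
have hz (F : {set 'I_n}) : kdiff (fun G => f0 G - kfun w G) F = 0.
  rewrite kdiffB; have [ci|ci] := eqVneq #|F| i.
    have [a <-] := ksets_enum ci; have /matrixP/(_ a ord0) := ew.
    by rewrite !mxE.
  rewrite kdiff_fun_out // subr0 /kdiff big1 // => t tF.
  by rewrite f0_out ?mulr0 // cardsU1 tF.
have [g eg] := kdiff_exact hz.
(* The coefficients of [g] in the squarefree multidegree [s], with signs that turn its boundary into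
   differences [c y - c x]. *)
pose c t : k := ksign t s * (g (s :\ t))@_U_(t).
have sD x y : x \in s -> y != x -> ksign y s = (-1) ^+ (x < y)%N * ksign y (s :\ x) :> k.
  by move=> xs yx; rewrite -{1}(finset.setD1K xs) ksignU1 // !inE eqxx.
have key x y : x \in s -> y \in s -> x != y ->
  ksign x s * ksign y s * (f0 (s :\ x :\ y) - kfun w (s :\ x :\ y))@_(U_(x) + U_(y)) =
  (-1) ^+ (y < x)%N * (c y - c x).
  move=> xs ys xy; set F := s :\ x :\ y; have yx : y != x by rewrite eq_sym.
  have cF : #|F| = i.+1 by exact: cD.
  have eF := eg F; rewrite -cards_eq0 cF addr0 in eF; rewrite eF.
  have xF : x \notin F by rewrite !inE eqxx !andbF.
  have yF : y \notin F by rewrite !inE eqxx.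
  have FE : F = s :\ y :\ x.
    by apply/finset.setP => z; rewrite !inE andbCA.
  have cfx : (x |: F) = s :\ y by rewrite FE finset.setD1K // !inE xy.
  have cfy : (y |: F) = s :\ x by rewrite finset.setD1K // !inE yx.
  rewrite /kdiff raddf_sum (bigD1 x) //= (bigD1 y) ?yF //= big1 ?addr0; last first.
    move=> t /andP[/andP[tF tx] ty]; rewrite -mulrA mcoeff_ksign mcoeffXU_mul.
    by rewrite mnmDE !mnm1E eq_sym (negPf tx) eq_sym (negPf ty) mulr0.
  rewrite -!mulrA !mcoeff_ksign !mcoeffXU_mul !mnmDE !mnm1E !eqxx cfx cfy.
  rewrite (_ : (U_(x) + U_(y) - U_(x))%MM = U_(y)%MM); last by rewrite addmC addmK.
  rewrite addmK addn1 /= /c.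
  have -> : ksign x F = (-1) ^+ (y < x)%N * ksign x s :> k.
    by rewrite (sD y x) // mulrA -expr2 sqrr_sign mul1r FE ksignD1id.
  have -> : ksign y F = (-1) ^+ (x < y)%N * ksign y s :> k.
    by rewrite (sD x y) // mulrA -expr2 sqrr_sign mul1r ksignD1id.
  set gx := (g (s :\ x))@_ _; set gy := (g (s :\ y))@_ _.
  have kx := @ksignK k _ x s; have ky := @ksignK k _ y s.
  transitivity ((ksign x s * ksign x s) * ((-1) ^+ (y < x)%N * (ksign y s * gy)) +
    (ksign y s * ksign y s) * ((-1) ^+ (x < y)%N * (ksign x s * gx))); first by ring.
  rewrite kx ky !mul1r; have : val x != val y by [].
  by case: ltngtP => //= _ _; rewrite ?expr0 ?expr1; ring.
have w0 x y : ~~ adj x y -> (kfun w (s :\ x :\ y))@_(U_(x) + U_(y)) = 0.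
  move=> nxy; rewrite /kfun raddf_sum big1 //= => a _.
  apply/memN_msupp_eq0/negP => /w1 h; move: nxy; rewrite (edgeM_U h) //.
have cuv : c u = c v.
  (* At a non-edge other than [uv] both [f0] and [w] have coefficient zero, so [c] is constant along
     it. *)
  apply: conn => x y xs ys xy nxy ne1 ne2; have := key x y xs ys xy.
  rewrite mcoeffB w0 // subr0 /f0.
  case: (_ =P F0) => [e|_].
    have hin z : z \in s -> z \notin F0 -> z = x \/ z = y.
      move=> zs; rewrite -e !inE zs andbT negb_and !negbK.
      by case/orP => /eqP; [right|left].
    have /hin[//|ux|uy] : u \notin F0 by rewrite !inE eqxx andbF.
      have /hin[//|vx|vy] : v \notin F0 by rewrite !inE eqxx.
        by rewrite ux vx eqxx in uv.
      by rewrite -ux -vy eqxx in ne1.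
    have /hin[//|vx|vy] : v \notin F0 by rewrite !inE eqxx.
      by rewrite -uy -vx eqxx in ne2.
    by rewrite uy vy eqxx in uv.
  rewrite mcoeff0 mulr0 => /esym/eqP; rewrite mulf_eq0 signr_eq0 subr_eq0 /=.
  by move/eqP.
(* At [uv] itself [f0] has coefficient 1, although the difference of [c] is zero. *)
have := key u v us vs uv; rewrite mcoeffB w0 // subr0 cuv subrr mulr0 /f0 eqxx.
move/eqP; rewrite -mpolyXD mcoeffX eqxx mulr1 mulf_eq0 /ksign !signr_eq0 //.
Qed.

End LowerBounds.

(** * The graphs of the chain *)

Section Least.

(** The default [D] is the value when no smaller number satisfies [Q]. *)
Definition least (D : nat) (Q : nat -> Prop) : nat :=
  ex_minn (ex_intro (fun x => `[< Q x >] || (x == D)) D (introT orP (or_intror (eqxx D)))).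

Lemma least_leD D Q : (least D Q <= D)%N.
Proof. by rewrite /least; case: ex_minnP => m _; apply; rewrite eqxx orbT. Qed.

Lemma least_le D (Q : nat -> Prop) x : Q x -> (least D Q <= x)%N.
Proof. by move=> Qx; rewrite /least; case: ex_minnP => m _; apply; rewrite asboolT. Qed.

Lemma leastP D Q : (least D Q < D)%N -> Q (least D Q).
Proof.
by rewrite /least; case: ex_minnP => m /orP[/asboolP //|/eqP ->]; rewrite ltnn.
Qed.

End Least.

Section Arcs.
Variables (r n : nat) (E : nat -> nat -> Prop).
Hypothesis E_lt : forall i j, E i j -> (i < j < r)%N.

(* [a < b] is an edge of the n-th graph iff some edge [i < j] of the r-th graph
   is moved to it by an increasing map, i.e. none of the three gaps to the left
   of [a], between [a] and [b], and to the right of [b] shrinks. *)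
Definition arc (a b : nat) : Prop :=
  exists i j, [/\ E i j, (i <= a)%N, (j + a <= b + i)%N & (r + b <= n + j)%N].

Definition adj (a b : 'I_n) : bool := `[< arc a b \/ arc b a >].

Lemma arc_lt a b : arc a b -> (a < b)%N.
Proof. by move=> [i [j [/E_lt]]]; lia. Qed.

Lemma adj_sym : ssrbool.symmetric adj.
Proof. by move=> a b; apply/asboolP/asboolP => -[]; [right|left|right|left]. Qed.

Lemma adj_irr : irreflexive adj.
Proof. by move=> a; apply/asboolP => -[] /arc_lt; rewrite ltnn. Qed.

Lemma adj_arc (a b : 'I_n) : (a < b)%N -> adj a b = `[< arc a b >].
Proof.
by move=> ab; apply/asboolP/asboolP => [[//|/arc_lt]|]; [lia|left].
Qed.

(** [wL a] is the least length of an arc from [a] when the right gap is no constraint, [wR b] that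
    of an arc into [b] when the left gap is none. The value [n] means that no such arc exists. *)
Definition wL (a : nat) := least n (fun w => exists i, E i (i + w) /\ (i <= a)%N).
Definition wR (b : nat) := least n (fun w => exists i, E i (i + w) /\ (r + b <= n + (i + w))%N).

(** Extremal edges: [d] is the least width; [im], [iM], [jm], [jM] are i-, i+, j-, j+, and [ja],
    [jb], [ia], [ib] are the other ends of edges attaining them. *)
Variables (i0 d ia jm iM jb im ja ib jM : nat).
Hypotheses (E0 : E i0 (i0 + d)) (E1 : E ia jm) (E2 : E iM jb) (E3 : E im ja) (E4 : E ib jM).
Hypothesis d_min : forall i j, E i j -> (i + d <= j)%N.
Hypothesis jm_min : forall i j, E i j -> (jm <= j)%N.
Hypothesis iM_max : forall i j, E i j -> (i <= iM)%N.
Hypothesis im_min : forall i j, E i j -> (im <= i)%N.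
Hypothesis jM_max : forall i j, E i j -> (j <= jM)%N.
Hypothesis n_big : (10 * r <= n)%N.

Lemma wL_arc a b : (a < b)%N -> (r + b <= n)%N -> arc a b <-> (wL a <= b - a)%N.
Proof.
move=> ab rb; have lt0 := E_lt E0; split.
  move=> [i [j [ij ia' jb' rj]]]; have := E_lt ij => ltij.
  have : (wL a <= j - i)%N; last by lia.
  by apply: least_le; exists i; split => //; rewrite subnKC //; lia.
move=> h; have [|i [ei ile]] := leastP (D := n) (Q := fun w => exists i, E i (i + w) /\ (i <= a)%N).
  by rewrite -/(wL a); lia.
exists i, (i + wL a)%N; split => //; lia.
Qed.

Lemma wR_arc a b : (a < b)%N -> (b < n)%N -> (r <= a)%N -> arc a b <-> (wR b <= b - a)%N.
Proof.
move=> ab bn ra; split.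
  move=> [i [j [ij ia' jb' rj]]]; have := E_lt ij => ltij.
  have : (wR b <= j - i)%N; last by lia.
  by apply: least_le; exists i; rewrite subnKC //; lia.
move=> h; have [|i [ei ile]] := leastP (D := n) 
    (Q := fun w => exists i, E i (i + w) /\ (r + b <= n + (i + w))%N).
  by rewrite -/(wR b); lia.
have := E_lt ei; rewrite -/(wR b) => lti.
by exists i, (i + wR b)%N; split => //; rewrite -?/(wR b) //; lia.
Qed.

Lemma wL_bounds a : [/\ (d <= wL a <= n)%N, (im <= a)%N -> (wL a < r)%N,
  (a < im)%N -> wL a = n & (r <= a)%N -> wL a = d].
Proof.
have lt0 := E_lt E0; have lt3 := E_lt E3.
have hn : (wL a <= n)%N by exact: least_leD.
have hd : (d <= wL a)%N.
  have [lt|] := ltnP (wL a) n; last by lia.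
  by have [i [ei _]] := leastP lt; have := d_min ei; rewrite -/(wL a); lia.
split.
- by rewrite hd.
- move=> h; suff : (wL a <= ja - im)%N by lia.
  by apply: least_le; exists im; rewrite subnKC //; lia.
- move=> h; have [lt|] := ltnP (wL a) n; last by lia.
  by have [i [ei ile]] := leastP lt; have := im_min ei; lia.
- move=> h; suff : (wL a <= d)%N by lia.
  by apply: least_le; exists i0; split=> //; lia.
Qed.

Lemma wR_bounds b : [/\ (d <= wR b <= n)%N, (r + b <= n + jM)%N -> (wR b < r)%N,
  (n + jM < r + b)%N -> wR b = n & (r + b <= n)%N -> wR b = d].
Proof.
have lt0 := E_lt E0; have lt4 := E_lt E4.
have hn : (wR b <= n)%N by exact: least_leD.
have hd : (d <= wR b)%N.
  have [lt|] := ltnP (wR b) n; last by lia.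
  by have [i [ei _]] := leastP lt; have := d_min ei; rewrite -/(wR b); lia.
split.
- by rewrite hd.
- move=> h; suff : (wR b <= jM - ib)%N by lia.
  by apply: least_le; exists ib; rewrite subnKC //; lia.
- move=> h; have [lt|] := ltnP (wR b) n; last by lia.
  by have [i [ei ile]] := leastP lt; have := jM_max ei; rewrite -/(wR b) in ile *; lia.
- move=> h; suff : (wR b <= d)%N by lia.
  by apply: least_le; exists i0; split=> //; lia.
Qed.

Lemma interval_arc (lft rgt : 'I_n -> int) (U : {set 'I_n}) :
  (forall a b : 'I_n, a \in U -> b \in U -> (a < b)%N ->
     ~ arc a b <-> lft a <= rgt b /\ lft b <= rgt a) ->
  (forall a : 'I_n, a \in U -> lft a <= rgt a) -> elim adj 1 U.
Proof.
move=> h1 h2; apply: (@elim_interval _ _ lft rgt) => a b aU bU.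
case: (ltngtP a b) => ab.
- rewrite adj_arc // -asbool_neg; apply/asboolP/andP => /h1 h; exact/h.
- rewrite adj_sym adj_arc // -asbool_neg andbC; apply/asboolP/andP => /h1 h; exact/h.
- by rewrite (ord_inj ab) adj_irr h2.
Qed.

(** The intervals of [a < b] meet iff [b - a < wL a + wR b - d]. One of the two widths is [d] unless
    [a] and [b] lie at opposite ends; then the edge from [im] to [jM] joins them, unless one is
    isolated and has width [n]. *)
Lemma elim1_corner : E im jM -> elim adj 1 finset.setT.
Proof.
move=> Ec; have ltc := E_lt Ec; have lt0 := E_lt E0.
apply: (@interval_arc (fun v => v%:Z - (wR v)%:Z + d%:Z) (fun v => v%:Z + (wL v)%:Z - 1)).
  move=> a b _ _ ab; have bn := ltn_ord b.
  have [a1 a2 a3 a4] := wL_bounds a; have [b1 b2 b3 b4] := wR_bounds b.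
  have [c1 _ _ _] := wL_bounds b; have [d1 _ _ _] := wR_bounds a.
  have [rb|rb] := leqP (r + b) n.
    by rewrite (wL_arc ab rb) b4 //; split; lia.
  have [ra|ra] := leqP r a.
    by rewrite (wR_arc ab bn ra) a4 //; split; lia.
  have [ai|ai] := leqP im a; last first.
    rewrite a3 //; split; first by lia.
    by move=> _ [i [j [/im_min]]]; lia.
  have [bj|bj] := leqP (r + b) (n + jM); last first.
    rewrite b3 //; split; first by lia.
    by move=> _ [i [j [/jM_max]]]; lia.
  split; last by lia.
  by case; exists im, jM; split=> //; lia.
move=> a _; have [a1 _ _ _] := wL_bounds a; have [b1 _ _ _] := wR_bounds a.
move: (d_min E0); have := E_lt E0; lia.
Qed.

Lemma elim2_setT : elim adj 2 finset.setT.
Proof.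
have lt0 := E_lt E0; have lt3 := E_lt E3; have lt4 := E_lt E4.
(* First the middle vertices. Non-isolated non-neighbours of [x] are close to it, where the arcs are
   the pairs at distance at least [d]; isolated vertices get an interval meeting all others. *)
pose A : {set 'I_n} := finset (fun x : 'I_n => (2 * r <= x)%N && (x + 2 * r <= n)%N).
apply: (@elim_order _ _ _ (fun => 0) _ A) => [|x U' xA xU' _ _ _|].
- by apply/fintype.subsetP => x _; rewrite inE.
- move: xA; rewrite inE => /andP[x1 x2].
  pose iso (v : 'I_n) := (v < im)%N || (n + jM < r + v)%N.
  have near (v : 'I_n) : v != x -> ~~ adj x v -> ~~ iso v -> (v < x + r)%N && (x < v + r)%N.
    rewrite /iso => vx xv; rewrite negb_or -!leqNgt => /andP[v1 v2].
    have : (v != x :> nat) by [].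
    case: (ltngtP v x) => // lt _.
      move: xv; rewrite adj_sym adj_arc // => /asboolP na.
      have [le|le] := ltnP x (v + r); first by lia.
      by case: na; exists im, ja; split=> //; lia.
    move: xv; rewrite adj_arc // => /asboolP na.
    have [le|le] := ltnP v (x + r); first by lia.
    by case: na; exists ib, jM; split=> //; lia.
  apply: (@interval_arc (fun v => if iso v then - n%:Z else v%:Z)
            (fun v => if iso v then n%:Z else v%:Z + d%:Z - 1)).
    move=> a b; rewrite !inE => /and3P[_ ax xa] /and3P[_ bx xb] ab.
    have bn := ltn_ord b.
    have isoN : iso a || iso b -> ~ arc a b.
      by rewrite /iso => h [i [j [e]]]; have := im_min e; have := jM_max e; lia.
    case: ifP => ia'; case: ifP => ib'; try by split; [lia|move=> _; apply: isoN; rewrite ia' ib'].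
    have := near a ax xa; have := near b bx xb; rewrite ia' ib' => /(_ isT) hb /(_ isT) ha.
    have [_ _ _ wa] := wL_bounds a.
    rewrite wL_arc // ?wa; lia.
  by move=> a _; case: ifP => _; lia.
pose L : {set 'I_n} := finset (fun x : 'I_n => (x < 2 * r)%N).
pose V : {set 'I_n} := finset.setT :\: A.
have VE (x : 'I_n) : (x \in V) = (x < 2 * r)%N || (n < x + 2 * r)%N.
  by rewrite !inE andbT negb_and -!ltnNge.
pose iso (v : 'I_n) := (n + jM < r + v)%N.
(* If all arcs start at the right end, [wR] decides them; the vertices at the left end get an
   interval meeting all others. *)
have intv (U : {set 'I_n}) :
    (forall a b : 'I_n, a \in U -> b \in U -> arc a b -> (n < a + 2 * r)%N) ->
    (forall a : 'I_n, a \in U -> (a < 2 * r)%N || (n < a + 2 * r)%N) ->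
    elim adj 1 U.
  move=> hU hV; apply: (@interval_arc
     (fun v => if (v < 2 * r)%N || iso v then - n%:Z else v%:Z - (wR v)%:Z + 1)
     (fun v => if (v < 2 * r)%N || iso v then n%:Z else v%:Z)).
    move=> a b aU bU ab; have an := ltn_ord a; have bn := ltn_ord b.
    have [b1 b2 b3 b4] := wR_bounds b; have [a1 _ _ _] := wR_bounds a.
    have N1 : (a < 2 * r)%N -> ~ arc a b by move=> h /(hU a b aU bU); lia.
    have N2 : iso a || iso b -> ~ arc a b.
      by rewrite /iso => h [i [j [e]]]; have := jM_max e; lia.
    have := hV _ aU; have := hV _ bU.
    have [al|al] := ltnP a (2 * r).
      by move=> /= _ _; split; [case: ifP|move=> _; apply: N1]; lia.
    have [ai|ai] := boolP (iso a).
      by move=> /= _ _; split; [case: ifP|move=> _; apply: N2; rewrite ai]; lia.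
    have [bi|bi] := boolP (iso b).
      by rewrite orbT /= => _ _; split; [lia|move=> _; apply: N2; rewrite bi orbT].
    have -> : (b < 2 * r)%N = false by lia.
    move=> /= _ _; rewrite wR_arc //; last by lia.
    by split; lia.
  move=> a aU; have [a1 _ _ _] := wR_bounds a; case: ifP => _; lia.
apply: (@elim_order _ _ _ (fun x : 'I_n => x%:Z) _ L) => [|x U' xL xU' _ sU mx|].
- by apply/fintype.subsetP => x; rewrite VE inE => ->.
- apply: intv => [a b|a]; last first.
    by rewrite inE -VE => /andP[/(fintype.subsetP sU)].
  rewrite !inE => /and3P[aU ax xa] /and3P[bU bx xb] ab.
  move: xL; rewrite inE => xL.
  have := VE a; rewrite (fintype.subsetP sU _ aU) => /esym/orP[aL|//].
  have lea : (a <= x)%N by have := mx a aU; rewrite inE aL => /(_ isT); lia.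
  have {ax} ax : (a < x)%N by rewrite ltn_neqAle lea andbT.
  (* Moving [b] to [x], or [a] to [x] if [b] is at the right end, gives an arc from [a] to [x] or
     from [x] to [b], a contradiction. *)
  move: ab => [i [j [e h1 h2 h3]]]; have := E_lt e => lte.
  have := VE b; rewrite (fintype.subsetP sU _ bU) => /esym/orP[bL|bR].
    have leb : (b <= x)%N by have := mx b bU; rewrite inE bL => /(_ isT); lia.
    have {bx} bx : (b < x)%N by rewrite ltn_neqAle leb andbT.
    by move: xa; rewrite adj_sym adj_arc // => /asboolP[]; exists i, j; split=> //; lia.
  move: xb; rewrite adj_arc; last by lia.
  by move/asboolP => []; exists i, j; split=> //; lia.
- apply: elimS; apply: intv => [a b|a]; rewrite finset.in_setD VE => /andP[//].
  by rewrite inE => /negPf ->.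
Qed.

(** The left half is removed from the middle down to [jm], then the right half from the middle up to
    [n + iM - r]. The rest has arcs only from the left end to the right end. *)
Lemma elim1_crossing : d = 1%N -> (exists i j, [/\ E i j, (i <= jm)%N & (iM <= j)%N]) ->
  elim adj 1 finset.setT.
Proof.
move=> d1 [ic [jc [Ec ic1 jc1]]]; have lt0 := E_lt E0; have lt1 := E_lt E1.
have lt2 := E_lt E2; have ltc := E_lt Ec.
have [h hn] : exists h, (2 * h <= n <= 2 * h + 1)%N by exists (n %/ 2)%N; lia.
pose A : {set 'I_n} := finset (fun x : 'I_n => (jm <= x < h)%N).
pose B : {set 'I_n} := finset (fun x : 'I_n => (h <= x)%N && (r + x <= n + iM)%N).
apply: (@elim_order _ _ _ (fun x : 'I_n => x%:Z) _ A) => [|x U' xA xU' _ _ mx|].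
- by apply/fintype.subsetP => x _; rewrite inE.
- move: xA; rewrite inE => xA.
  suff indep (y z : 'I_n) : y \in U' -> z \in U' -> y != x -> z != x ->
      ~~ adj x y -> ~~ adj x z -> ~ arc y z.
    apply: elim_indep => y z; rewrite !inE => /and3P[yU yx xy] /and3P[zU zx xz].
    by apply/asboolP => -[]; apply: indep.
  move=> yU zU yx zx xy xz yz; have ltyz := arc_lt yz.
  have small (w : 'I_n) : w \in U' -> w != x -> (w < h)%N -> (w < x)%N.
    move=> wU wx wh; rewrite ltn_neqAle wx /=; have [wj|wj] := ltnP w jm; first by lia.
    by have := mx w wU; rewrite inE wj wh => /(_ isT); lia.
  (* Both vertices are near the middle, where [d = 1] makes distinct vertices adjacent. *)
  have far (w : 'I_n) : ~~ adj x w -> (x < w)%N -> (h <= w)%N -> (w < x + r)%N -> False.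
    move=> nxw ltw hw rw; have xh : (x < h)%N by case/andP: xA.
    move: nxw; rewrite adj_arc // => /asboolP[].
    by exists i0, (i0 + d)%N; split=> //; lia.
  have [i [j [e h1 h2 h3]]] := yz; have := E_lt e => lte; have := iM_max e => iiM.
  have zn := ltn_ord z.
  have [zh|zh] := ltnP z h.
    have zx' := small z zU zx zh.
    by move: xy; rewrite adj_sym adj_arc; [move=> /asboolP[]; exists i, j; split=> //; lia|lia].
  have [yh|yh] := ltnP y h.
    have yx' := small y yU yx yh; have [rz|/(far _ xz)] := leqP (x + r) z; last by lia.
    by move: xz; rewrite adj_arc; [move=> /asboolP[]; exists i, j; split=> //; lia|lia].
  (* The crossing edge joins [x] to [y]: [ic <= jm <= x], and [r + y <= n + iM <= n + jc]. *)
  have [ry|/(far _ xy)] := leqP (x + r) y; last by lia.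
  by move: xy; rewrite adj_arc; [move=> /asboolP[]; exists ic, jc; split=> //; lia|lia].
set V := finset.setT :\: A.
have VE (x : 'I_n) : (x \in V) = (x < jm)%N || (h <= x)%N.
  by rewrite !inE andbT negb_and -leqNgt -ltnNge.
apply: (@elim_order _ _ _ (fun x : 'I_n => - x%:Z) _ B) => [|x U' xB xU' _ sU mx|].
- by apply/fintype.subsetP => x; rewrite VE inE => /andP[-> _]; rewrite orbT.
- move: xB; rewrite inE => xB.
  suff indep (y z : 'I_n) : y \in U' -> z \in U' -> y != x -> z != x ->
      ~~ adj x y -> ~~ adj x z -> ~ arc y z.
    apply: elim_indep => y z; rewrite !inE => /and3P[yU yx xy] /and3P[zU zx xz].
    by apply/asboolP => -[]; apply: indep.
  move=> yU zU yx zx xy xz yz; have ltyz := arc_lt yz.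
  have big (w : 'I_n) : w \in U' -> w != x -> (h <= w)%N -> (x < w)%N.
    move=> wU wx wh; rewrite ltn_neqAle eq_sym wx /=.
    have [wj|wj] := leqP (r + w) (n + iM); last by lia.
    by have := mx w wU; rewrite inE wj wh => /(_ isT); lia.
  have [i [j [e h1 h2 h3]]] := yz; have := E_lt e => lte; have := jm_min e => jjm.
  have := VE z; rewrite (fintype.subsetP sU _ zU) => /esym/orP[zl|zh]; first by lia.
  have xz' := big z zU zx zh.
  have := VE y; rewrite (fintype.subsetP sU _ yU) => /esym/orP[yl|yh].
    by move: xy; rewrite adj_sym adj_arc; [move=> /asboolP[]; exists i, j; split=> //; lia|lia].
  have xy' := big y yU yx yh.
  by move: xz; rewrite adj_arc //; move=> /asboolP[]; exists i, j; split=> //; lia.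
(* The first start of an arc into [b]: a left vertex [a] is joined to [b] iff [theta b <= a], that
   is, iff [-a < 1 - theta b]. *)
pose theta (b : nat) := least n (fun i => exists j, E i j /\ (r + b <= n + j)%N).
apply: (@interval_arc (fun v => if (v < h)%N then - n%:Z else 1 - (theta v)%:Z)
   (fun v => if (v < h)%N then - v%:Z else n%:Z)); last first.
  by move=> a _; have an := ltn_ord a; case: ifP => _; lia.
move=> a b aU bU ab; have an := ltn_ord a; have bn := ltn_ord b.
have U3 (x : 'I_n) : x \in V :\: B ->
    ((x < jm)%N || (h <= x)%N) /\ ((h <= x)%N -> (n + iM < r + x)%N).
  rewrite finset.in_setD VE => /andP[xB ->]; split=> // hx.
  by move: xB; rewrite inE hx /= -ltnNge.
have [a1 a2] := U3 a aU; have [b1 b2] := U3 b bU.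
case: ifP => ah; case: ifP => bh.
- split; first by lia.
  by move=> _ [i [j [e h1 h2 h3]]]; have := jm_min e; lia.
- have tn : (theta b <= n)%N by exact: least_leD.
  split=> [nab|[_ hab] [i [j [e h1 h2 h3]]]]; last first.
    by have : (theta b <= i)%N; [apply: least_le; exists j|lia].
  split; first by lia.
  have [lt|] := leqP (theta b) a; last by lia.
  have [|j [e h1]] := leastP (D := n) 
    (Q := fun i => exists j, E i j /\ (r + b <= n + j)%N).
    by rewrite -/(theta b); lia.
  have lte := E_lt e; rewrite -/(theta b) in e lte *.
  by case: nab; exists (theta b), j; split=> //; lia.
- by lia.
- split; first by have := least_leD n; lia.
  by move=> _ [i [j [e h1 h2 h3]]]; have := iM_max e; lia.
Qed.

(** * Nonvanishing Tor for the graphs of the chain *)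

Variable k : fieldType.

Lemma nonadj_arc (a b : 'I_n) : ~ arc a b -> (a < b)%N -> ~~ adj a b.
Proof. by move=> nab ab; rewrite adj_arc //; apply/asboolP. Qed.

Lemma arc_adj (a b : 'I_n) : arc a b -> adj a b.
Proof. by move=> ab; apply/asboolP; left. Qed.

(* The complement contains the cycle [u, u+1, ..., v, u], where [(u, v)] is a
   maximal pair that is not an edge because it is too close to the two ends. *)
Lemma Tor_long_cycle : ~ E im jM -> (2 <= d)%N ->
  exists i, Tor_neq0 (monI k (edgeM adj finset.setT)) i i.+3%:Z.
Proof.
move=> nE d2; have lt3 := E_lt E3; have lt4 := E_lt E4.
(* [i1] is the least start of an edge ending at [jM], and [r - s] below is the greatest end of an
   edge starting before [i1]. So [v] is the first vertex too far right for arcs from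
   [u = i1 - 1]. *)
pose i1 := least r (fun i => E i jM).
have i1b : (i1 <= ib)%N by exact: least_le.
have Ei1 : E i1 jM by apply: (leastP (D := r) (Q := fun i => E i jM)); rewrite -/i1; lia.
have i1m : (im < i1)%N.
  by have := im_min Ei1; rewrite leq_eqVlt => /orP[/eqP e|//]; rewrite -e in Ei1.
pose s := least r (fun s => exists2 i, (i < i1)%N & E i (r - s)).
have sb : (s <= r - ja)%N.
  by apply: least_le; exists im; rewrite // subKn //; lia.
have [i2 i21 Ei2] : exists2 i, (i < i1)%N & E i (r - s).
  by apply: (leastP (D := r) (Q := fun s => exists2 i, (i < i1)%N & E i (r - s))); rewrite -/s; lia.
have lti2 := E_lt Ei2; have jMs := jM_max Ei2.
have s_min i j : (i < i1)%N -> E i j -> (j <= r - s)%N.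
  move=> ii Eij; have ltj := E_lt Eij.
  have : (s <= r - j)%N by apply: least_le; exists i; rewrite // subKn //; lia.
  by lia.
have sM : (r - s < jM)%N.
  rewrite ltn_neqAle jMs andbT; apply/eqP => e; rewrite e in Ei2.
  by have : (i1 <= i2)%N; [exact: least_le|lia].
have un : (i1.-1 < n)%N by lia.
have vn' : (n + (r - s) + 1 - r < n)%N by lia.
pose u := Ordinal un; pose v := Ordinal vn'.
have nuv : ~ arc u v.
  move=> [i [j [e /= h1 h2 h3]]]; have ii : (i < i1)%N by lia.
  by have := s_min i j ii e; lia.
pose S := finset (fun x : 'I_n => (u <= x <= v)%N).
have wn : (i1 < n)%N by lia.
pose w := Ordinal wn.
have cS : exists i, #|S| = i.+3.
  have [uS wS vS] : [/\ u \in S, w \in S & v \in S] by rewrite !inE /=; split; lia.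
  exists #|S :\ u :\ w :\ v|.
  rewrite (cardsD1 u) uS (cardsD1 w (S :\ u)) (cardsD1 v (S :\ u :\ w)).
  by rewrite !finset.in_setD1 wS vS -!(inj_eq val_inj) /=; lia.
have [i ci] := cS; exists i.
apply: (Tor_cycle_neq0 adj_sym adj_irr (s := S) (u := u) (v := v)) => //.
- by rewrite inE /=; lia.
- by rewrite inE /=; lia.
- by rewrite -(inj_eq val_inj) /=; lia.
- by apply: nonadj_arc => //=; lia.
- move=> t; rewrite inE => /andP[ut tv]; rewrite -!(inj_eq val_inj) /= => tu tv'.
  (* Since [t > u], the edge from [i1] to [jM] can join [t] to [v]; since [t < v], the one from [i2]
     to [r - s] can join [u] to [t]. Distance decides which one fits. *)
  rewrite /= in ut tv; have [far|near] := leqP (t + r) v.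
    apply/orP; right; rewrite adj_sym; apply: arc_adj.
    by exists i1, jM; split=> //=; rewrite /= in far; lia.
  by apply/orP; left; apply: arc_adj; exists i2, (r - s)%N; rewrite /= in near; split=> //=; lia.
- move=> c hc; suff path m : forall x : 'I_n, nat_of_ord x = (u + m)%N -> (x <= v)%N -> c u = c x.
    by apply: (path (v - u)%N) => //=; lia.
  elim: m => [|m IH] x ex xv.
    by congr c; apply: val_inj; rewrite /= ex addn0.
  rewrite /= in ex xv; have yn : (u + m < n)%N by have := ltn_ord x; rewrite /=; lia.
  rewrite (IH (Ordinal yn)) //=; last by lia.
  apply: hc; rewrite ?inE ?xpair_eqE -?(inj_eq val_inj) /=; try lia.
  apply: nonadj_arc => /=; last by lia.
  by move=> [i' [j' [/d_min e h1 h2 h3]]]; lia.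
Qed.

(** An edge ending at [jm], placed leftmost, and one starting at [iM], placed rightmost, induce two
    disjoint edges, as an arc between them would come from a crossing edge. The complement is a
    4-cycle. *)
Lemma Tor_square : ~ (exists i j, [/\ E i j, (i <= jm)%N & (iM <= j)%N]) ->
  Tor_neq0 (monI k (edgeM adj finset.setT)) 1 4.
Proof.
move=> nE; have lt1 := E_lt E1; have lt2 := E_lt E2.
have an : (ia < n)%N by lia.
have a'n : (jm < n)%N by lia.
have bn : (n + iM - r < n)%N by lia.
have b'n : (n + jb - r < n)%N by lia.
pose a := Ordinal an; pose a' := Ordinal a'n; pose b := Ordinal bn; pose b' := Ordinal b'n.
have aa : adj a a' by apply: arc_adj; exists ia, jm; split=> //=; lia.
have bb : adj b b' by apply: arc_adj; exists iM, jb; split=> //=; lia.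
have cross (x y : 'I_n) : (x <= jm)%N -> (n + iM - r <= y)%N -> ~~ adj x y.
  move=> hx hy; apply: nonadj_arc; last by lia.
  by move=> [i [j [e h1 h2 h3]]]; apply: nE; exists i, j; split=> //; lia.
pose S := finset (pred_of_simpl (pred4 a a' b b')).
have ne : uniq [:: a; a'; b; b'].
  by rewrite /= !inE -!(inj_eq val_inj) /=; lia.
have SE x : (x \in S) = (x \in [:: a; a'; b; b']) by rewrite !inE.
apply: (Tor_cycle_neq0 adj_sym adj_irr (s := S) (u := a) (v := b)).
- by rewrite (eq_card SE) (card_uniqP ne).
- by rewrite SE !inE eqxx.
- by rewrite SE !inE eqxx ?orbT.
- by rewrite -(inj_eq val_inj) /=; lia.
- by apply: cross => /=; lia.
- move=> t; rewrite SE !inE => /or4P[]/eqP->; rewrite ?eqxx // => _ _.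
    by rewrite aa.
  by rewrite bb orbT.
- move=> c hc.
  have h (x y : 'I_n) : (x <= jm)%N -> (n + iM - r <= y)%N -> x \in S -> y \in S ->
     ((x, y) != (a, b)) -> c x = c y.
    move=> hx hy xS yS xy; apply: hc => //; first by rewrite -(inj_eq val_inj) /=; lia.
      exact: cross.
    by rewrite xpair_eqE negb_and -(inj_eq val_inj) /=; apply/orP; left; lia.
  have inS : [/\ a \in S, a' \in S, b \in S & b' \in S].
    by rewrite !SE !inE !eqxx !orbT.
  case: inS => aS a'S bS b'S.
  have e1 : c a = c b' by apply: h; rewrite ?xpair_eqE -?(inj_eq val_inj) //=; lia.
  have e2 : c a' = c b' by apply: h; rewrite ?xpair_eqE -?(inj_eq val_inj) //=; lia.
  have e3 : c a' = c b by apply: h; rewrite ?xpair_eqE -?(inj_eq val_inj) //=; lia.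
  by rewrite e1 -e2.
Qed.

End Arcs.

(** * Regularity of the chain *)

Section Regularity.
Variables (k : fieldType) (n : nat).

Lemma reg_eq (M : set 'X_{1..n}) (d : int) i :
  (forall P : resolution_k k n, reg_le P M d) -> Tor_neq0 (monI k M) i (d + i%:Z) ->
  reg (monI k M) = d%:E%E.
Proof.
move=> ub Td; rewrite /reg; set A := (X in supremum _ X).
have Ad : A d%:E%E by exists i, (d + i%:Z); split; [|congr (_%:E); lia].
have supA : supremums A d%:E%E.
  split=> [x [i' [j [[P nP] ->]]]|x]; last by apply.
  rewrite lee_fin leNgt; apply/negP => lt; apply: nP; exact: (ub P).
rewrite /supremum; case: ifP => [/eqP A0|_]; first by rewrite A0 in Ad.
(* [supremum] chooses an element of the set of suprema, which has only one. *)
by apply: (is_subset1_supremums _ supA); apply: xgetI supA.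
Qed.

Variables (r : nat) (E : nat -> nat -> Prop).
Hypothesis E_lt : forall i j, E i j -> (i < j < r)%N.
Hypothesis n_big : (10 * r <= n)%N.
Local Notation J := (monI k (edgeM (@adj r n E) finset.setT)).

Lemma Tor0_arc i j : E i j -> Tor_neq0 J 0 2.
Proof.
move=> e; have lt := E_lt e.
have i_n : (i < n)%N by lia.
have j_n : (j + n - r < n)%N by lia.
apply: (@Tor0_neq0 _ _ _ (adj_irr E_lt) (Ordinal i_n) (Ordinal j_n)).
by apply: arc_adj; exists i, j; split=> //=; lia.
Qed.

Lemma reg_arc2 i j : E i j -> elim (@adj r n E) 1 finset.setT -> reg J = 2%:E%E.
Proof.
move=> e el; apply: (@reg_eq _ 2 0); last by rewrite addr0; exact: Tor0_arc e.
by move=> P; have := elim_reg_le (@adj_sym _ _ _) (adj_irr E_lt) (P := P) el; apply.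
Qed.

Lemma reg_arc3 i : elim (@adj r n E) 2 finset.setT -> Tor_neq0 J i i.+3%:Z ->
  reg J = 3%:E%E.
Proof.
move=> el T3; apply: (@reg_eq _ 3 i).
  by move=> P; have := elim_reg_le (@adj_sym _ _ _) (adj_irr E_lt) (P := P) el; apply.
by have -> : 3 + i%:Z = i.+3%:Z by lia.
Qed.

End Regularity.

Lemma exists_min (Q : nat -> Prop) : (exists i, Q i) ->
  exists2 i, Q i & forall j, Q j -> (i <= j)%N.
Proof.
move=> [i0 Qi0]; pose m := least i0.+1 Q.
have le : (m <= i0)%N by exact: least_le.
exists m; first by apply: (leastP (D := i0.+1) (Q := Q)); rewrite -/m ltnS.
by move=> j; exact: least_le.
Qed.

Lemma exists_max (Q : nat -> Prop) r : (exists i, Q i) -> (forall i, Q i -> (i < r)%N) ->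
  exists2 i, Q i & forall j, Q j -> (j <= i)%N.
Proof.
move=> [i0 Qi0] lt; have [|i Qi min] := @exists_min (fun i => Q (r - i)%N).
  by exists (r - i0)%N; rewrite subKn // ltnW // lt.
exists (r - i)%N => // j Qj; have := lt j Qj.
by have := min (r - j)%N; rewrite subKn; [move=> /(_ Qj); lia|exact/ltnW/lt].
Qed.

(** The case distinction involves only [E], so the value is the same for all fields and all large
    [n]. *)
Lemma reg_arc_const (r : nat) (E : nat -> nat -> Prop) :
  (forall i j, E i j -> (i < j < r)%N) -> (exists i j, E i j) ->
  exists2 d : int, d = 2 \/ d = 3 & forall (k : fieldType) n, (10 * r <= n)%N ->
    reg (monI k (edgeM (@adj r n E) finset.setT)) = d%:E%E.
Proof.
move=> E_lt [a [b Eab]].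
have [|d [i0 E0] d_min] := @exists_min (fun d => exists i, E i (i + d)%N).
  by exists (b - a)%N, a; rewrite subnKC //; have := E_lt _ _ Eab; lia.
have {}d_min i j : E i j -> (i + d <= j)%N.
  move=> e; have lt := E_lt _ _ e; suff : (d <= j - i)%N by lia.
  by apply: d_min; exists i; rewrite subnKC //; lia.
have [|im [ja E3] im_min'] := @exists_min (fun i => exists j, E i j); first by exists a, b.
have [|jm [ia E1] jm_min'] := @exists_min (fun j => exists i, E i j); first by exists b, a.
have [||iM [jb E2] iM_max'] := @exists_max (fun i => exists j, E i j) r.
- by exists a, b.
- by move=> i [j /E_lt]; lia.
have [||jM [ib E4] jM_max'] := @exists_max (fun j => exists i, E i j) r.
- by exists b, a.
- by move=> j [i /E_lt]; lia.
have im_min i j : E i j -> (im <= i)%N by move=> e; apply: im_min'; exists j.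
have jm_min i j : E i j -> (jm <= j)%N by move=> e; apply: jm_min'; exists i.
have iM_max i j : E i j -> (i <= iM)%N by move=> e; apply: iM_max'; exists j.
have jM_max i j : E i j -> (j <= jM)%N by move=> e; apply: jM_max'; exists i.
have el2 n : (10 * r <= n)%N -> elim (@adj r n E) 2 finset.setT.
  by move=> nb; exact: (elim2_setT E_lt E0 E3 E4 d_min im_min jM_max nb).
have [Ec|nEc] := pselect (E im jM).
  exists 2; first by left.
  move=> k n nb; apply: (reg_arc2 k E_lt nb Eab).
  exact: (elim1_corner E_lt E0 E3 E4 d_min im_min jM_max nb Ec).
have [cr|ncr] := pselect (exists i j, [/\ E i j, (i <= jm)%N & (iM <= j)%N]); last first.
  exists 3; first by right.
  move=> k n nb; apply: (@reg_arc3 k _ _ _ E_lt nb 1%N); first exact: el2.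
  exact: (Tor_square E_lt E1 E2 nb k ncr).
have [d2|d1] := ltnP 1 d.
  exists 3; first by right.
  move=> k n nb.
  have [i T3] := Tor_long_cycle E_lt E3 E4 d_min im_min jM_max nb k nEc d2.
  by apply: (reg_arc3 E_lt nb _ T3); exact: el2.
exists 2; first by left.
move=> k n nb; apply: (reg_arc2 k E_lt nb Eab).
have {}d1 : d = 1%N by have := E_lt _ _ E0; lia.
exact: (elim1_crossing E_lt E0 E1 E2 jm_min iM_max nb d1 cr).
Qed.

(** * From the chain of ideals to the graphs *)

Section Chain.
Variables (k : fieldType) (r : nat).
Hypothesis r_gt0 : (0 < r)%N.
Variable M : set 'X_{1..r}.
Hypothesis M_sqfree : forall m, M m -> sqfree_quadratic m.

Definition genE (i j : nat) : Prop := exists x y : 'I_r,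
  [/\ nat_of_ord x = i, nat_of_ord y = j, (x < y)%N & M (U_(x) + U_(y))%MM].

Lemma genE_lt i j : genE i j -> (i < j < r)%N.
Proof. by move=> [x [y [<- <- xy _]]]; rewrite xy ltn_ord. Qed.

Lemma sqfree_pair m : M m -> exists x y : 'I_r, (x < y)%N /\ m = (U_(x) + U_(y))%MM.
Proof.
move=> Mm; have [m2 m1] := M_sqfree Mm.
have [x mx] : exists x, (0 < m x)%N.
  apply/existsP; rewrite -[X in is_true X]negbK; apply/negP => /existsPn h.
  suff e : m = 0%MM by rewrite e mdeg0 in m2.
  by apply/mnmP => x; rewrite mnm0E; have := h x; lia.
have ex : m = ((m - U_(x)) + U_(x))%MM.
  by rewrite submK //; apply/mnm_lepP => z; rewrite mnm1E; case: eqP => // <-.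
have : mdeg (m - U_(x))%MM == 1%N.
  by move: m2; rewrite {1}ex mdegD mdeg1; lia.
rewrite mdeg_eq1 => /existsP[y /eqP ey]; rewrite ey in ex.
have xy : x != y :> nat.
  have := m1 x; rewrite ex mnmDE !mnm1E eqxx; case: eqVneq => [->//|ne _].
  by rewrite eq_sym.
case: (ltngtP x y) xy => // lt _; last by exists y, x.
by exists x, y; split=> //; rewrite addmC.
Qed.

Lemma Inc_mono p : Inc p -> forall i j, (i <= j)%N -> (p i + (j - i) <= p j)%N.
Proof.
move=> hp i j; elim: j => [|j IH] ij; first by have e0 : i = 0%N; [lia|rewrite e0; lia].
have [e|lt] := eqVneq i j.+1; first by rewrite e; lia.
have ij' : (i <= j)%N by lia.
by have := hp j j.+1 (ltnSn j); have := IH ij'; lia.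
Qed.

Lemma Inc_arc n p i j : Inc_mn r n p -> genE i j -> arc r n genE (p i) (p j).
Proof.
move=> [hp pn] e; have lt := genE_lt e; have mono := Inc_mono hp.
have h0 := mono 0%N i; have h1 := mono i j; have h2 := mono j r.-1.
by exists i, j; split=> //; lia.
Qed.

Lemma arc_Inc n a b : arc r n genE a b ->
  exists p i j, [/\ Inc_mn r n p, genE i j, p i = a & p j = b].
Proof.
move=> [i [j [e ia jb rb]]]; have lt := genE_lt e.
(* Shifting by [a - i] from [i] on and by [b - j] from [j] on is increasing because the middle gap
   does not shrink; the right gap keeps the image of [r.-1] below [n]. *)
exists (fun x => if (x < i)%N then x
  else if (x < j)%N then (x + (a - i))%N else (x + (b - j))%N), i, j.
split=> //; last 2 first.
- by rewrite ltnn; case: ifP; lia.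
- by rewrite ltnn; case: ifP; lia.
split; last by repeat (case: ifP => ?); lia.
by move=> x y xy; repeat (case: ifP => ?); lia.
Qed.

Lemma xvarE n (x : 'I_n) : xvar k n x = 'X_x.
Proof. by rewrite /xvar valK. Qed.

Lemma Inc_actX n p (x y : 'I_r) : Inc_act n p ('X_[U_(x) + U_(y)] : {mpoly k[r]}) =
  xvar k n (p x) * xvar k n (p y).
Proof. by rewrite /Inc_act mpolyXD rmorphM /= !comp_mpolyXU -!tnth_nth !tnth_mktuple. Qed.

Lemma chain_edgeM (I : forall n, set {mpoly k[n]}) n :
  Inc_invariant_chain I -> stable_from I r -> I r = ideal_gen [set 'X_[m] | m in M] ->
  (r <= n)%N -> I n = monI k (edgeM (@adj r n genE) finset.setT).
Proof.
move=> I_chain I_stable I_r rn.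
have [id0 idD idM] := I_chain.1 n (leq_trans r_gt0 rn).
have [_ /(_ n rn) En] := I_stable.
set J := monI _ _.
have idJ : is_ideal J by apply/monI_ideal/edgeM_upclosed.
have inJ p i j : Inc_mn r n p -> genE i j -> J (xvar k n (p i) * xvar k n (p j)).
  move=> hp e; have pij := Inc_arc hp e; have [i' [j' [e' h1 h2 h3]]] := pij.
  have lt := genE_lt e'; have ltp := arc_lt genE_lt pij.
  have pj : (p j < n)%N by lia.
  have pi : (p i < n)%N by lia.
  rewrite -[p i]/(nat_of_ord (Ordinal pi)) -[p j]/(nat_of_ord (Ordinal pj)) !xvarE.
  move=> m /msuppXX ->; exists (Ordinal pi), (Ordinal pj).
  rewrite !inE !mnmDE !mnm1E !eqxx; split=> //; try lia.
  by left.
apply/seteqP; split.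
  rewrite En; apply: smallest_sub => // g [p [f [hp fI ->]]].
  (* The polynomials sent into [J] form an ideal, so checking the generators of [I r] suffices. *)
  have idf : is_ideal [set f : {mpoly k[r]} | J (Inc_act n p f)].
    have [J0 JD JM] := idJ; split=> /=; first by rewrite /Inc_act rmorph0.
      by move=> x y; rewrite /Inc_act rmorphD; exact: JD.
    by move=> c x; rewrite /Inc_act rmorphM; exact: JM.
  rewrite I_r in fI; have := smallest_sub idf _ fI; apply.
  move=> _ [m Mm <-] /=; have [x [y [xy em]]] := sqfree_pair Mm.
  by rewrite em Inc_actX; apply: inJ => //; exists x, y; rewrite -em.
move=> f fJ; rewrite [f]mpolyE big_seq; elim/big_ind: _ => // m /fJ.
move=> [a [b [_ _ /asboolP ab ma mb]]]; rewrite -mul_mpolyC; apply: (idM).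
wlog {ab} ab : a b ma mb / arc r n genE a b.
  by move=> h; case: ab; [apply: h|apply: (h b a)].
have nab : b != a by have := arc_lt genE_lt ab; rewrite neq_ltn orbC => ->.
(* The arc is the image of an edge of [I r], so its monomial is in the orbit generating [I n]. *)
have [p [i [j [hp [x [y [<- <- xy Mxy]]] pi pj]]]] := arc_Inc ab.
have -> : m = ((m - U_(a) - U_(b)) + (U_(a) + U_(b)))%MM.
  apply/mnmP => z; rewrite !(mnmDE, mnmBE, mnm1E).
  by case: (eqVneq a z) => [<-|_]; [rewrite (negPf nab)|case: (eqVneq b z) => [<-|_]]; lia.
rewrite mpolyXD; apply: (idM); rewrite En; apply: sub_gen_smallest.
exists p, 'X_[U_(x) + U_(y)]; split=> //.
  by rewrite I_r; apply: sub_gen_smallest; exists (U_(x) + U_(y))%MM.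
by rewrite Inc_actX pi pj !xvarE mpolyXD.
Qed.

End Chain.

Local Open Scope ereal_scope.

Theorem theorem1p2 (r : nat) (hr : (1 <= r)%N) :
  exists N : nat,
    forall (k : fieldType) (I : forall n : nat, set {mpoly k[n]}),
      Inc_invariant_chain I ->
      (forall n : nat, (1 <= n)%N -> edge_ideal (I n)) ->
      eventually_nonzero I ->
      stability_index I r ->
      forall n : nat, (N <= n)%N ->
        reg (I n) = reg (I n.+1) /\
        (reg (I n) = 2%:E \/ reg (I n) = 3%:E).
Proof.
exists (10 * r)%N => k I chain edge nonzero [stable _] n nb.
have [M [Msq IM]] := edge r hr.
have IE n' : (r <= n')%N -> I n' = monI k (edgeM (@adj r n' (genE M)) finset.setT).
  exact: (chain_edgeM hr Msq chain stable IM).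
(* Without edges at [r] all later ideals would be zero. *)
have [i [j eij]] : exists i j, genE M i j.
  apply: contrapT => nE; have [n0 /(_ (maxn n0 r)) nz] := nonzero.
  apply: nz; first exact: leq_maxl.
  rewrite IE ?leq_maxr //; apply/seteqP; split=> f; last by move=> ->; exact: monI0.
  move=> fJ; apply/mpolyP => m; rewrite mcoeff0; apply/memN_msupp_eq0/negP => /fJ.
  move=> [x [y [_ _ /asboolP xy _ _]]]; apply: nE.
  by case: xy => -[i [j [e _ _ _]]]; exists i, j.
have [|d d23 regd] := @reg_arc_const r (genE M) (@genE_lt r M); first by exists i, j.
rewrite !IE; try lia.
rewrite !regd; try lia.
by split=> //; case: d23 => ->; [left|right].
Qed.
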